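(* Let $r \geq 3$ be an integer. There exist positive constants $c_1, c_2$ (depending on $r$) such that for all sufficiently large integers $k$, $$c_1 k^{\frac{r-1}{r-2}} (\log k)^{-\frac{1}{r-2}} \leq g(K_r,k) \leq c_2 k^{\frac{r+1}{r-1}} (\log k)^{\frac{r+1}{r-1} - \frac{2}{(r-1)(r-2)}}.$$
   Context: A graph is $H$-free if it contains no (not necessarily induced) copy of $H$. A graph is $k$-choosable if it admits a proper colouring from any assignment of lists of size $k$ to its vertices. $g(H,k)$ is the largest integer $g$ such that every $H$-free graph on at most $g$ vertices is $k$-choosable. $\log$ is the natural logarithm. *)

(* Defs.v *)
From mathcomp Require Import all_boot.
From Stdlib Require Import ClassicalEpsilon.

Set Implicit Arguments.
Unset Strict Implicit.
Unset Printing Implicit Defensive.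

Definition simple_graph (n : nat) (e : rel 'I_n) : Prop :=
  irreflexive e /\ symmetric e.

Definition contains_copy (m n : nat) (eH : rel 'I_m) (eG : rel 'I_n) : Prop :=
  exists f : 'I_m -> 'I_n, injective f /\ forall i j, eH i j -> eG (f i) (f j).

Definition H_free (m n : nat) (eH : rel 'I_m) (eG : rel 'I_n) : Prop :=
  ~ contains_copy eH eG.

Definition K (r : nat) : rel 'I_r := fun i j => i != j.

Definition choosable (k n : nat) (e : rel 'I_n) : Prop :=
  forall L : 'I_n -> seq nat,
    (forall v, uniq (L v) /\ size (L v) = k) ->
    exists c : 'I_n -> nat,
      (forall v, c v \in L v) /\ (forall u v, e u v -> c u != c v).

Definition g_good (m : nat) (eH : rel 'I_m) (k g : nat) : Prop :=
  forall n, n <= g -> forall e : rel 'I_n,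
    simple_graph e -> H_free eH e -> choosable k e.

Definition is_g (m : nat) (eH : rel 'I_m) (k g : nat) : Prop :=
  g_good eH k g /\ forall g', g_good eH k g' -> g' <= g.

(* g(H,k): the largest g such that every H-free graph on at most g vertices
   is k-choosable (chosen by classical choice; it exists for H = K_r, r >= 3). *)
Definition g_fun (m : nat) (eH : rel 'I_m) (k : nat) : nat :=
  epsilon (inhabits 0) (fun g => is_g eH k g).

(* Main.v *)
Require Import Defs.
From mathcomp Require Import all_boot all_order all_algebra.
From mathcomp Require Import Rstruct Rstruct_topology.
From mathcomp Require Import reals sequences exp.
From mathcomp Require Import ring lra zify.
Set Implicit Arguments.
Unset Strict Implicit.
Unset Printing Implicit Defensive.
Import Order.TTheory GRing.Theory Num.Theory.

(** Lower bound. Let s = t^(r-2). A K_r-free graph on t * j vertices is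
    colourable from lists of size 4 s + j. As long as some vertex v has more
    than s uncoloured neighbours with a common colour c in their lists, these
    neighbours span no K_(r-1), hence contain t pairwise non-adjacent vertices;
    give them all the colour c and remove c from the other lists, which happens
    at most j times. When no such v exists, a counting argument of Rosenfeld
    shows that each new vertex multiplies the number of partial colourings by
    at least 2 s.

    Upper bound. With constant lists, it suffices to have a K_r-free graph on n
    vertices in which every k-set spans an edge, where q * k < n. Such a graph
    is produced by a weighted online version of the K_r-free process: the pairs
    are examined in a fixed order, a pair f of current weight w f is accepted
    with probability p * w f, and the weights of the undecided pairs that would
    complete a K_r together with f are set to 0 if f is accepted, and divided
    by 1 - p * w f otherwise. Each weight is then a martingale. Two potentials
    are supermartingales: one bounds the probability that a given set of pairs
    is accepted, hence also the moments of the number of nearly complete r-sets,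
    so that the process is unlikely to be stopped; one bounds the probability
    that a given k-set spans no edge. A union bound concludes. *)

(** * List colouring of sparse graphs *)

Section LowerBound.
Local Open Scope nat_scope.

(** The weights exist to undo the loss caused by closing. Dividing by [1 - p * w f] on rejection
    exactly offsets the risk of being set to 0 on acceptance, so the mean acceptance probability of
    a pair stays at [p] until the stop, and a k-set spans no edge with probability about e^(-p
    C(k,2)), as if the pairs were independent. The price is that weights grow; [haz] records how
    much, through [wt s g <= expR (2 * haz s g)]. The obstacle is dependence, since one acceptance
    may close many pairs at once. This is measured by [haz2]. Two pairs closed together share their
    larger end, so a pair inside a k-set has at most k partners there, and an error linear in k per
    pair is affordable, while one of order k^2 would not be. The density is that of the K_r-free
    process: the expected hazard, of order n^(r-2) p^(C(r,2)-1), has to be a small multiple of log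
    n, which gives p of order n^(-2/(r+1)) (log n)^(1/(C(r,2)-1)); then k of order (log n) / p lets
    the union bound over k-sets succeed. *)

Lemma card_bigcup_le (I T : finType) (P : pred I) (F : I -> {set T}) :
  #|\bigcup_(i | P i) F i| <= \sum_(i | P i) #|F i|.
Proof.
apply: (big_ind2 (fun (X : {set T}) m => #|X| <= m)); rewrite ?cards0 // => X m Y k Xm Yk.
by apply: leq_trans (leq_card_setU X Y) _; apply: leq_add.
Qed.

Section ListColouring.
Variables (V C : finType) (e : rel V).
Hypothesis e_sym : symmetric e.
Hypothesis e_irr : irreflexive e.

(** * Independent sets in graphs without large cliques *)

Definition clique (A : {set V}) := [forall u in A, forall v in A, (u != v) ==> e u v].
Definition indep (A : {set V}) := [forall u in A, forall v in A, ~~ e u v].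

Lemma cliqueP (A : {set V}) :
  reflect (forall u v, u \in A -> v \in A -> u != v -> e u v) (clique A).
Proof.
apply: (iffP forall_inP) => [h u v uA vA uv|h u uA].
  by have /forall_inP/(_ v vA)/implyP := h u uA; apply.
by apply/forall_inP => v vA; apply/implyP; apply: h.
Qed.

Lemma indepP (A : {set V}) :
  reflect (forall u v, u \in A -> v \in A -> ~~ e u v) (indep A).
Proof.
apply: (iffP forall_inP) => [h u v uA vA|h u uA].
  by have /forall_inP := h u uA; apply.
by apply/forall_inP => v vA; apply: h.
Qed.

Lemma clique_nbr v (A B : {set V}) : clique B -> B \subset [set u in A | e v u] ->
  clique (v |: B) /\ #|v |: B| = #|B|.+1.
Proof.
move=> /cliqueP cB /subsetP BA; split.
  apply/cliqueP => x y /setU1P[->|xB] /setU1P[->|yB].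
  - by rewrite eqxx.
  - by have := BA _ yB; rewrite inE => /andP[].
  - by have := BA _ xB; rewrite inE e_sym => /andP[].
  - exact: cB.
rewrite cardsU1; case vB: (v \in B) => //.
by have := BA _ vB; rewrite inE e_irr andbF.
Qed.

(** Greedy choice: picking v costs at most d vertices, namely v and its fewer than d neighbours. *)
Lemma sparse_indep d j (A : {set V}) : 0 < d ->
  (forall v, v \in A -> #|[set u in A | e v u]| < d) -> j * d <= #|A| ->
  exists I : {set V}, [/\ I \subset A, #|I| = j & indep I].
Proof.
move=> d0; elim: j A => [|j IH] A dA jA.
  exists set0; rewrite sub0set cards0; split=> //; apply/indepP => u v; rewrite inE //.
have [v vA] : exists v, v \in A.
  by apply/set0Pn; rewrite -card_gt0 (leq_trans _ jA) // muln_gt0.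
pose B := (A :\ v) :\: [set u in A | e v u].
have [] := IH B.
- move=> u; rewrite !inE => /andP[_ /andP[_ uA]]; apply: leq_ltn_trans (dA u uA).
  by apply: subset_leq_card; apply/subsetP => w; rewrite !inE => /andP[/and3P[_ _ ->] ->].
- have := cardsD (A :\ v) [set u in A | e v u].
  have := cardsD1 v A; rewrite vA -/B.
  have : #|(A :\ v) :&: [set u in A | e v u]| <= #|[set u in A | e v u]|.
    by apply: subset_leq_card; apply: subsetIr.
  have := dA v vA; lia.
move=> I [IB Ij iI]; exists (v |: I).
have /subsetP IB' := IB.
have vI : v \notin I by apply/negP => /IB'; rewrite !inE eqxx andbF.
split.
- apply/subsetP => x /setU1P[->//|/IB']; by rewrite !inE => /and3P[].
- by rewrite cardsU1 vI Ij.
have nv u : u \in I -> ~~ e v u.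
  by move/IB'; rewrite !inE negb_and => /and3P[/orP[/negP//|//] _ uA]; rewrite uA.
apply/indepP => x y /setU1P[->|xI] /setU1P[->|yI].
- by rewrite e_irr.
- exact: nv.
- by rewrite e_sym nv.
- by have /indepP := iI; apply.
Qed.

(** Ramsey-type induction on m: either some neighbourhood has t^m vertices, and its cliques are
    smaller by one because v can be added to them, or all degrees are below t^m and the greedy
    choice succeeds among t * t^m vertices. *)
Lemma ramsey_indep t m (A : {set V}) : 0 < t -> t ^ m <= #|A| ->
  (forall B : {set V}, B \subset A -> clique B -> #|B| <= m) ->
  exists I : {set V}, [/\ I \subset A, #|I| = t & indep I].
Proof.
move=> t0; elim: m A => [|m IH] A tA cA.
  have [v vA] : exists v, v \in A by apply/set0Pn; rewrite -card_gt0.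
  have := cA [set v]; rewrite cards1 sub1set => /(_ vA) h; suff /h : clique [set v] by [].
  by apply/cliqueP => x y /set1P-> /set1P->; rewrite eqxx.
have [/exists_inP[v vA dv]|] := boolP [exists v in A, t ^ m <= #|[set u in A | e v u]|].
  have [|I [IA It iI]] := IH _ dv.
    move=> B BA cB; have [c1 c2] := clique_nbr cB BA.
    rewrite -ltnS -c2; apply: cA => //; rewrite subUset sub1set vA.
    by apply: subset_trans BA _; apply/subsetP => x; rewrite inE => /andP[].
  exists I; split=> //.
  by apply: subset_trans IA _; apply/subsetP => x; rewrite inE => /andP[].
rewrite negb_exists_in => /forall_inP dA.
apply: (@sparse_indep (t ^ m)); rewrite ?expn_gt0 ?t0 // -?expnS //.
by move=> v vA; rewrite ltnNge dA.
Qed.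

(* Updating coordinate v preserves Q, so f v is uniform on B and takes each value
   at most a fraction 1 / #|B| of the time. *)
Lemma card_coordinate (Q : {set {ffun V -> C}}) (v : V) (c : C) (B : {set C}) :
  (forall f b, f \in Q -> b \in B -> [ffun u => if u == v then b else f u] \in Q) ->
  #|[set f in Q | f v == c]| * #|B| <= #|Q|.
Proof.
move=> QB; rewrite -cardsX.
pose g (x : {ffun V -> C} * C) := [ffun u => if u == v then x.2 else x.1 u].
rewrite -(@card_in_imset _ _ g).
  apply: subset_leq_card; apply/subsetP => _ /imsetP[[f b] + ->].
  by rewrite in_setX inE => /andP[/andP[/= fQ _] bB]; apply: QB.
move=> [f b] [f' b']; rewrite !in_setX !inE /= => /andP[/andP[_ /eqP fv] _].
move=> /andP[/andP[_ /eqP fv'] _] /ffunP ff.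
have := ff v; rewrite !ffunE eqxx /= => ->; congr (_, _).
apply/ffunP => u; have := ff u; rewrite !ffunE /=; case: eqP => // -> _.
by rewrite fv fv'.
Qed.

(** * Counting partial colourings *)

Section Rosenfeld.
Variables (L : V -> {set C}) (A : {set V}) (s : nat).
Hypothesis s0 : 0 < s.
Hypothesis list_size : forall v, v \in A -> 4 * s <= #|L v|.
Hypothesis colour_degree : forall v c, #|[set u in A | e v u && (c \in L u)]| <= s.

(** Total functions for which the lists bind on all of A but properness only on S: recolouring a
    vertex outside S from its list never leaves the set, so such a coordinate is uniform on its
    list. *)
Definition colourings (S : {set V}) : {set {ffun V -> C}} :=
  [set f : {ffun V -> C} | [forall v in A, f v \in L v] &&
    [forall u in S, forall v in S, e u v ==> (f u != f v)]].

Lemma colouringsP (S : {set V}) (f : {ffun V -> C}) :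
  reflect ((forall v, v \in A -> f v \in L v) /\
           (forall u v, u \in S -> v \in S -> e u v -> f u != f v))
          (f \in colourings S).
Proof.
rewrite inE; apply: (iffP andP) => [[/forall_inP h1 /forall_inP h2]|[h1 h2]]; split=> //.
- by move=> u v uS vS; have /forall_inP/(_ v vS)/implyP := h2 u uS; apply.
- exact/forall_inP.
- by apply/forall_inP => u uS; apply/forall_inP => v vS; apply/implyP; apply: h2.
Qed.

Lemma colourings_update (S : {set V}) v b f : v \notin S -> f \in colourings S -> b \in L v ->
  [ffun u => if u == v then b else f u] \in colourings S.
Proof.
move=> vS /colouringsP[f1 f2] bL; apply/colouringsP; split=> [u uA|u w uS wS].
  by rewrite ffunE; case: eqP => [->|_] //; apply: f1.
rewrite !ffunE; case: (u =P v) => [uv|_]; first by rewrite -uv uS in vS.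
by case: (w =P v) => [wv|_]; [rewrite -wv wS in vS|exact: f2].
Qed.

(* Values outside S are free, so the factor 1/2 means that the number of
   colourings of S alone grows by at least #|L v| / 2 >= 2 * s. *)
Lemma colourings_extend (S : {set V}) v : S \subset A -> v \in A -> v \notin S ->
  #|colourings S| <= 2 * #|colourings (v |: S)|.
Proof.
have [m] := ubnP #|S|; elim: m S v => // m IH S v Sm SA vA vS.
pose P := #|colourings S|; pose l := #|L v|.
have l4 : 4 * s <= l := list_size vA.
pose D c := [set u in A | e v u && (c \in L u)].
pose B c u := [set f in colourings S | [&& u \in S, f v == c & f u == c]].
(* Removing u from S frees both u and v: they take the colour c for a fraction at most 1 / l and 1 /
   (4 s) of the colourings of [S :\ u], whose number is at most 2 P by induction. *)
have cardB c u : u \in D c -> #|B c u| * (l * (4 * s)) <= 2 * P.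
  rewrite inE => /and3P[uA _ cu].
  case uS : (u \in S); last first.
    rewrite [B c u](_ : _ = set0) ?cards0 //.
    by apply/setP => f; rewrite !inE uS andbF.
  pose Q := colourings (S :\ u).
  pose Q1 := [set f in Q | f u == c].
  have uv : u != v by apply: contraNneq vS => <-.
  have h1 : #|[set f in Q1 | f v == c]| * l <= #|Q1|.
    apply: card_coordinate => f b; rewrite inE => /andP[fQ fu] bL.
    rewrite inE ffunE (negPf uv) fu andbT; apply: colourings_update => //.
    by rewrite !inE (negPf vS) andbF.
  have h2 : #|Q1| * #|L u| <= #|Q|.
    apply: card_coordinate => f b fQ bL; apply: colourings_update => //.
    by rewrite !inE eqxx.
  have h3 : #|Q| <= 2 * P.
    rewrite /P -(setD1K uS); apply: IH => //; last by rewrite !inE eqxx.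
      by move: Sm; rewrite (cardsD1 u) uS.
    by apply: subset_trans SA; apply: subD1set.
  have h4 : #|B c u| <= #|[set f in Q1 | f v == c]|.
    apply: subset_leq_card; apply/subsetP => f.
    rewrite [in X in X -> _]inE => /andP[fS /and3P[_ fv fu]]; rewrite inE fv andbT inE fu andbT.
    have [f1 f2] := colouringsP _ _ fS; apply/colouringsP; split=> // x y.
    by rewrite !inE => /andP[_ xS] /andP[_ yS]; apply: f2.
  rewrite mulnA; apply: leq_trans h3; apply: leq_trans h2.
  apply: leq_mul (list_size uA); apply: leq_trans h1; exact: leq_mul.
pose W := \bigcup_(c in L v) \bigcup_(u in D c) B c u.
(* There are l colours and at most s neighbours for each, hence l * s * 2 P / (l * 4 s) = P / 2
   spoiled colourings. *)
have W2 : #|W| * 2 <= P.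
  have h : #|W| * (l * (4 * s)) <= l * (s * (2 * P)).
    apply: leq_trans (leq_mul (card_bigcup_le _ _) (leqnn _)) _.
    rewrite big_distrl /=; apply: leq_trans (_ : \sum_(c in L v) s * (2 * P) <= _); last first.
      by rewrite sum_nat_const.
    apply: leq_sum => c _; apply: leq_trans (leq_mul (card_bigcup_le _ _) (leqnn _)) _.
    rewrite big_distrl /=; apply: (@leq_trans (\sum_(u in D c) 2 * P)).
      by apply: leq_sum => u; apply: cardB.
    by rewrite sum_nat_const leq_mul2r colour_degree orbT.
  rewrite -(@leq_pmul2r (l * s * 2)) //; last by rewrite !muln_gt0 s0 andbT /=; lia.
  by lia.
have cover : colourings S \subset colourings (v |: S) :|: W.
  apply/subsetP => f fS; rewrite inE; case: (boolP (f \in colourings (v |: S))) => //= /colouringsP nf.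
  have [f1 f2] := colouringsP _ _ fS.
  have [/exists_inP[u uS /andP[uv /eqP fuv]]|] := boolP [exists u in S, e v u && (f u == f v)].
    apply/bigcupP; exists (f v); first exact: f1.
    apply/bigcupP; exists u; last by rewrite inE fS uS fuv !eqxx.
    by rewrite inE (subsetP SA) // uv -fuv f1 // (subsetP SA).
  rewrite negb_exists_in => /forall_inP g; case: nf; split=> // x y.
  have gg w : w \in S -> e v w -> f w != f v.
    by move=> wS vw; have := g w wS; rewrite vw.
  move=> /setU1P[->|xS] /setU1P[->|yS]; first by rewrite e_irr.
  - by move=> vy; rewrite eq_sym gg.
  - by rewrite e_sym; apply: gg.
  - exact: f2.
have := subset_leq_card cover; have := leq_of_leqif (leq_card_setU (colourings (v |: S)) W).
rewrite -/P; lia.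
Qed.

Lemma exists_colouring (c0 : C) : exists f : {ffun V -> C}, f \in colourings A.
Proof.
suff h (S : {set V}) : S \subset A -> 0 < #|colourings S|.
  by have := h A (subxx A); rewrite card_gt0 => /set0Pn.
have [m] := ubnP #|S|; elim: m S => // m IH S Sm SA.
have [S0|[v vS]] := set_0Vmem S; last first.
  have vA := subsetP SA v vS.
  have := @colourings_extend (S :\ v) v (subset_trans (subD1set _ _) SA) vA.
  rewrite !inE eqxx setD1K // => /(_ isT) h.
  have : 0 < #|colourings (S :\ v)|.
    apply: IH; last exact: subset_trans (subD1set _ _) SA.
    by move: Sm; rewrite (cardsD1 v) vS.
  by lia.
have L0 v : v \in A -> exists c, c \in L v.
  move=> vA; apply/set0Pn; rewrite -card_gt0 (leq_trans _ (list_size vA)) //.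
  by rewrite muln_gt0.
have [f fP] : exists f : {ffun V -> C}, forall v, v \in A -> f v \in L v.
  exists [ffun v => odflt c0 [pick c in L v]] => v vA; rewrite ffunE.
  by case: pickP => [//|h]; have [c cL] := L0 v vA; rewrite h in cL.
by rewrite card_gt0; apply/set0Pn; exists f; apply/colouringsP; split=> // u v; rewrite S0 inE.
Qed.
End Rosenfeld.

(** Induction on j: a colour class of t vertices lowers the bound t * j on A by t and each list by
    at most one colour, so 4 t^(r-2) colours always remain for the counting argument. *)
Lemma list_colouring r t j (A : {set V}) (L : V -> {set C}) : 2 < r -> 0 < t ->
  (forall B : {set V}, clique B -> #|B| < r) -> C ->
  #|A| <= t * j -> (forall v, v \in A -> 4 * t ^ (r - 2) + j <= #|L v|) ->
  exists f : V -> C, forall v, v \in A -> f v \in L v /\ (forall u, u \in A -> e u v -> f u != f v).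
Proof.
move=> r2 t0 cl c0; elim: j A L => [|j IH] A L Aj Ls.
  exists (fun _ => c0) => v vA; move: Aj; rewrite muln0 leqn0 cards_eq0 => /eqP A0.
  by rewrite A0 inE in vA.
pose s := t ^ (r - 2).
have s0 : 0 < s by rewrite expn_gt0 t0.
have [/existsP[v /existsP[c Dc]]|nD] :=
  boolP [exists v, [exists c, s < #|[set u in A | e v u && (c \in L u)]|]]; last first.
  have [|v c|f /colouringsP[f1 f2]] := @exists_colouring L A s s0 _ _ c0.
  - by move=> v vA; rewrite (leq_trans _ (Ls v vA)) // leq_addr.
  - by rewrite leqNgt; apply: contra nD => h; apply/existsP; exists v; apply/existsP; exists c.
  exists f => v vA; split; first exact: f1.
  by move=> u uA; apply: f2.
(* Cliques among neighbours of v have at most r - 2 vertices, since v extends them. *)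
have [|I [ID It iI]] := @ramsey_indep t (r - 2) _ t0 (ltnW Dc).
  move=> B BD cB; have [|c1 c2] := @clique_nbr v A B cB.
    by apply: subset_trans BD _; apply/subsetP => x; rewrite !inE => /and3P[-> ->].
  by have := cl _ c1; rewrite c2; lia.
have ID' u : u \in I -> u \in A /\ c \in L u.
  by move/(subsetP ID); rewrite inE => /and3P[].
have [|u uA|f fP] := IH (A :\: I) (fun u => L u :\ c).
- have IA : I \subset A by apply/subsetP => u /ID'[].
  by have := cardsD A I; rewrite (setIidPr IA) It; nia.
- move: uA; rewrite inE => /andP[_ uA].
  by have := Ls u uA; rewrite (cardsD1 c (L u)); case: (c \in L u) => /=; lia.
exists (fun u => if u \in I then c else f u) => u uA.
have fc w : w \in A -> w \notin I -> f w \in L w /\ f w != c.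
  move=> wA wI; have [] := fP w; first by rewrite inE wI.
  by rewrite !inE => /andP[].
have [uI|uI] := boolP (u \in I).
  split; first by have [] := ID' u uI.
  move=> w wA; case: ifP => [wI|/negbT wI] ewu.
    by have /indepP/(_ w u wI uI) := iI; rewrite ewu.
  by have [] := fc w wA wI.
have [uL uc] := fc u uA uI; split=> // w wA ewu.
case: ifP => [_|/negbT wI]; first by rewrite eq_sym.
have [|_ h] := fP u; first by rewrite inE uI.
by apply: h => //; rewrite inE wI.
Qed.
End ListColouring.

Lemma choosable_clique_free n (e : rel 'I_n) r t j k : 2 < r -> 0 < t ->
  simple_graph e -> H_free (@K r) e -> n <= t * j -> 4 * t ^ (r - 2) + j <= k -> choosable k e.
Proof.
move=> r2 t0 [e_irr e_sym] Kfree nt jk L Lk.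
have cl (B : {set 'I_n}) : clique e B -> #|B| < r.
  move=> /cliqueP cB; rewrite ltnNge; apply/negP => rB; apply: Kfree.
  exists (fun i => enum_val (widen_ord rB i)); split.
    by move=> i j'; move/enum_val_inj => /(congr1 val) /= /val_inj.
  move=> i j' ij; apply: cB; rewrite ?enum_valP //.
  by apply: contraNneq ij => /enum_val_inj/(congr1 val) /= /val_inj->.
(* All lists together fit into a finite type of colours. *)
pose q := (\max_v \max_(c <- L v) c).+1.
have Lq v c : c \in L v -> c < q.
  move=> cL; rewrite ltnS; apply: leq_trans (leq_bigmax v); exact: leq_bigmax_seq.
pose LC v := [set c : 'I_q | val c \in L v].
have LCk v : k <= #|LC v|.
  have [uL <-] := Lk v; rewrite cardE -(size_map val); apply: uniq_leq_size => // c cL.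
  by apply/mapP; exists (Ordinal (Lq v c cL)); rewrite // mem_enum inE.
have [||f fP] := @list_colouring 'I_n 'I_q e e_sym e_irr r t j setT LC r2 t0 cl ord0.
- by rewrite cardsT card_ord.
- by move=> v _; apply: leq_trans (LCk v).
exists (fun v => val (f v)); split=> [v|u v uv].
  by have [] := fP v (in_setT v); rewrite inE.
by have [_ /(_ u (in_setT u) uv)] := fP v (in_setT v); apply: contra_neq => /val_inj.
Qed.
End LowerBound.

Local Open Scope ring_scope.

(** * Pairs of vertices and the order of examination *)

Section Pairs.
Variable n : nat.
Implicit Types (A B : {set 'I_n}) (f g h : 'I_n * 'I_n).

Definition prs A : {set 'I_n * 'I_n} :=
  [set g | [&& g.1 \in A, g.2 \in A & (g.1 < g.2)%N]].

(* Pairs are examined by increasing larger end, then increasing smaller end. *)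
Definition rank g : nat := (g.2 * n + g.1)%N.

Lemma in_prs A g : (g \in prs A) = [&& g.1 \in A, g.2 \in A & (g.1 < g.2)%N].
Proof. by rewrite inE. Qed.

Lemma prsS A B : A \subset B -> prs A \subset prs B.
Proof.
move=> /subsetP sAB; apply/subsetP => g; rewrite !in_prs.
by case/and3P=> /sAB -> /sAB -> ->.
Qed.

Lemma rank_lt2 f g : (f.2 < g.2)%N -> (rank f < rank g)%N.
Proof.
move=> fg; rewrite /rank.
apply: (@leq_trans (f.2.+1 * n)%N).
  by rewrite mulSn addnC ltn_add2r.
by apply: leq_trans (leq_addr _ _); rewrite leq_mul2r fg orbT.
Qed.

Lemma rank_lt1 f g : f.2 = g.2 -> (rank f < rank g)%N = (f.1 < g.1)%N.
Proof. by move=> fg; rewrite /rank fg ltn_add2l. Qed.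

Lemma rank_inj : injective rank.
Proof.
move=> f g fg.
have e2 : f.2 = g.2.
  by apply/val_inj; case: (ltngtP f.2 g.2) => // /rank_lt2; rewrite fg ltnn.
have e1 : f.1 = g.1.
  by move: fg; rewrite /rank e2 => /addnI /val_inj.
by case: f g e1 e2 {fg} => [f1 f2] [g1 g2] /= -> ->.
Qed.

Lemma card_prs A : #|prs A| = 'C(#|A|, 2).
Proof.
rewrite -(card_in_imset (f := fun g : 'I_n * 'I_n => [set g.1; g.2])); last first.
  move=> [a b] [c d]; rewrite !in_prs /= => /and3P[_ _ ab] /and3P[_ _ cd] E.
  have : a \in [set c; d] by rewrite -E !inE eqxx.
  have : b \in [set c; d] by rewrite -E !inE eqxx orbT.
  rewrite !inE => /orP[/eqP eb|/eqP eb] /orP[/eqP ea|/eqP ea]; subst.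
  - by rewrite ltnn in ab.
  - by move: (ltn_trans ab cd); rewrite ltnn.
  - by [].
  - by rewrite ltnn in ab.
rewrite -cards_draws; apply: eq_card => B.
rewrite inE; apply/imsetP/andP.
  case=> [[a b]]; rewrite in_prs /= => /and3P[aA bA ab] ->; split.
    by apply/subsetP => x; rewrite !inE => /orP[]/eqP->.
  by rewrite cards2 neq_ltn ab.
case=> /subsetP BA /cards2P[a [b [ab EB]]].
have [aA bA] : a \in A /\ b \in A by split; apply: BA; rewrite EB !inE eqxx ?orbT.
case: (ltngtP a b) => lab.
- by exists (a, b); rewrite ?in_prs /= ?aA ?bA ?lab.
- by exists (b, a); rewrite ?in_prs /= ?aA ?bA ?lab // EB setUC.
- by case/eqP: ab; apply/val_inj.
Qed.

End Pairs.

(** * The weighted online process *)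

Section Process.
Variables (R : realType) (n r : nat).
Variables (p sigma eta lam : R).
Notation V := 'I_n.
Notation P := ('I_n * 'I_n)%type.
Implicit Types (A B : {set V}) (f g h : P) (U Q F : {set P}).

(* haz s g sums the acceptance probabilities of the examined pairs that closed g,
   haz2 s g h those of the pairs that closed g and h simultaneously. *)
Record state := State {
  dec : {set P};
  gr : {set P};
  wt : P -> R;
  haz : P -> R;
  haz2 : P -> P -> R }.

Definition closes (s : state) f : {set P} :=
  [set g | [&& g \notin dec s, g != f &
    [exists A : {set V}, [&& #|A| == r, f \in prs A, g \in prs A &
                             prs A :\ f :\ g \subset gr s]]]].

Definition accept_prob s f := p * wt s f.

Definition incl s f : state :=
  State (f |: dec s) (f |: gr s)
    (fun g => if g \in closes s f then 0 else wt s g)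
    (fun g => haz s g + (g \in closes s f)%:R * accept_prob s f)
    (fun g h => haz2 s g h +
       ([&& g \in closes s f, h \in closes s f & g != h])%:R * accept_prob s f).

Definition excl s f : state :=
  State (f |: dec s) (gr s)
    (fun g => if g \in closes s f then wt s g / (1 - accept_prob s f) else wt s g)
    (fun g => haz s g + (g \in closes s f)%:R * accept_prob s f)
    (fun g h => haz2 s g h +
       ([&& g \in closes s f, h \in closes s f & g != h])%:R * accept_prob s f).

(* The process is frozen as soon as this fails. *)
Definition active s f : bool :=
  [&& [forall g, haz s g <= sigma],
      [forall g, forall h, haz2 s g h <= eta] &
      \sum_(g in closes s f) p * wt s g <= sigma].

(* Expectation of Psi at the end of the process, starting from s with the pairs l
   left to examine. *)
Fixpoint Ex (l : seq P) (s : state) (Psi : state -> R) : R :=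
  if l is f :: l' then
    if active s f then
      accept_prob s f * Ex l' (incl s f) Psi +
      (1 - accept_prob s f) * Ex l' (excl s f) Psi
    else Psi s
  else Psi s.

(** The states at which [Ex] evaluates its argument: nothing is left to examine, or the process is
    frozen. *)
Definition terminal (l : seq P) s := if l is f :: _ then ~~ active s f else true.

(** A majorant of [haz] that reads only the current state: if m closed g, some r-set contains both
    and all its other pairs are accepted. The weight of m no longer changes after its decision. In
    this form moments can be computed. *)
Definition hazbound s g : R :=
  \sum_(A : {set V} | (#|A| == r) && (g \in prs A))
    \sum_(m in prs A :\ g | m \in dec s)
      (prs A :\ g :\ m \subset gr s)%:R * (p * wt s m).

(** The same for pairs g and h closed together. Besides the r-set through g and m, the pair
    [(m.1, h.1)] has to be accepted; this extra pair is what makes the sum tiny. *)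
Definition haz2bound s g h : R :=
  \sum_(A : {set V} | [&& #|A| == r, g \in prs A & h.1 \notin A])
    \sum_(m in prs A :\ g | [&& m \in dec s, m.1 != g.1 , m.1 != g.2 & (m.1 < h.1)%N])
      ((prs A :\ g :\ m \subset gr s) && ((m.1, h.1) \in gr s))%:R * (p * wt s m).

(** The margin [lam] in the bounds on [haz] and [haz2] allows for the last step before freezing. By
    [inv_clique], a pair about to complete a K_r has weight 0 and cannot be accepted, which
    maintains [inv_free]. *)
Record inv (l : seq P) s : Prop := Inv {
  inv_sorted : sorted ltn [seq rank g | g <- l];
  inv_lt : forall d x, d \in dec s -> x \in l -> (rank d < rank x)%N;
  inv_cover : forall g, (g \in prs setT) = (g \in dec s) || (g \in l);
  inv_gr : gr s \subset dec s;
  inv_wt0 : forall g, 0 <= wt s g;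
  inv_haz0 : forall g, 0 <= haz s g;
  inv_haz20 : forall g h, 0 <= haz2 s g h;
  inv_wtle : forall g, wt s g <= expR (2 * haz s g);
  inv_hazle : forall g, haz s g <= sigma + lam;
  inv_haz2le : forall g h, haz2 s g h <= eta + lam;
  inv_clique : forall A g, #|A| = r -> g \in prs A -> g \notin dec s ->
      prs A :\ g \subset gr s -> wt s g = 0;
  inv_free : forall A, #|A| = r -> ~~ (prs A \subset gr s);
  inv_hazb : forall g, haz s g <= hazbound s g;
  inv_haz2b : forall g h, haz2 s g h <= haz2bound s g h;
  inv_row : forall g h, g.2 != h.2 -> haz2 s g h = 0;
  inv_diag : forall g, haz2 s g g = 0 }.

Hypothesis r3 : (3 <= r)%N.
Hypothesis p0 : 0 < p.
Hypothesis sigma0 : 0 < sigma.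
Hypothesis eta0 : 0 < eta.
Hypothesis lam12 : lam <= 1 / 2%:R.
Hypothesis plam : p * expR (2 * (sigma + lam)) <= lam.

(** * Preservation of the invariant *)

Lemma lam0 : 0 < lam.
Proof. by apply: lt_le_trans plam; rewrite mulr_gt0 ?expR_gt0. Qed.

Lemma pwt_le l s g : inv l s -> p * wt s g <= lam.
Proof.
move=> I; apply: le_trans plam; rewrite ler_pM2l //.
apply: le_trans (inv_wtle I g) _; rewrite ler_expR.
by rewrite ler_pM2l // (inv_hazle I).
Qed.

Lemma prob_ge0 l s f : inv l s -> 0 <= accept_prob s f.
Proof. by move=> I; rewrite mulr_ge0 ?(inv_wt0 I) // ltW. Qed.

Lemma prob_le12 l s f : inv l s -> accept_prob s f <= 1 / 2%:R.
Proof. by move=> I; apply: le_trans lam12; apply: (pwt_le f I). Qed.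

Lemma head_notin_dec f l s : inv (f :: l) s -> f \notin dec s.
Proof.
move=> I; apply/negP => fd.
by have := inv_lt I fd (mem_head f l); rewrite ltnn.
Qed.

(* In the order of examination, a K_r is completed by its last two pairs; these
   share their larger end, which is what makes haz2 small. *)
Lemma closes_row f l s A g : inv (f :: l) s ->
  #|A| = r -> f \in prs A -> g \in prs A -> g \notin dec s -> g != f ->
  prs A :\ f :\ g \subset gr s ->
  [/\ g.2 = f.2, (f.1 < g.1)%N &
      forall a, a \in A -> a != g.1 -> a != g.2 -> (a <= f.1)%N].
Proof.
move=> I cA fA gA gd gf sub.
(* The remaining pairs of A are accepted, hence examined before f. *)
have inD h : h \in prs A -> h != f -> h != g -> (rank h < rank f)%N.
  move=> hA hf hg; apply: (inv_lt I) (mem_head _ _).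
  apply: (subsetP (inv_gr I)); apply: (subsetP sub).
  by rewrite !in_setD1 hg hf.
have fg : (rank f < rank g)%N.
  have gl : g \in f :: l.
    have : g \in prs setT by apply: (subsetP (prsS (subsetT A))).
    by rewrite (inv_cover I) (negbTE gd).
  move: gl; rewrite inE (negbTE gf) /= => gl.
  have := inv_sorted I; rewrite /= (path_sortedE ltn_trans) => /andP[/allP S _].
  by apply: S; apply: map_f.
move: (fA) (gA); rewrite !in_prs => /and3P[f1 f2 f12] /and3P[g1 g2 g12].
have g2f2 : g.2 = f.2.
  apply/val_inj; case: (ltngtP g.2 f.2) => // lt.
    by have := ltn_trans (rank_lt2 lt) fg; rewrite ltnn.
  (* If f.2 < g.2, both ends of f are joined to g.2 inside A. At most one of these two pairs is g;
     the other is accepted, although it comes after f. *)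
  have a1 : (f.1, g.2) \in prs A by rewrite in_prs /= f1 g2 (ltn_trans f12).
  have a2 : (f.2, g.2) \in prs A by rewrite in_prs /= f2 g2 lt.
  have b1 : (f.1, g.2) != f by apply/eqP => E; move: lt; rewrite -E /= ltnn.
  have b2 : (f.2, g.2) != f by apply/eqP => E; move: lt; rewrite -E /= ltnn.
  case: (altP ((f.1, g.2) =P g)) => [E|E].
    have : (f.2, g.2) != g by rewrite -{2}E xpair_eqE eqxx andbT neq_ltn f12 orbT.
    move=> /(inD _ a2 b2) L; have := ltn_trans L (@rank_lt2 _ f (f.2, g.2) lt).
    by rewrite ltnn.
  have L := inD _ a1 b1 E; have := ltn_trans L (@rank_lt2 _ f (f.1, g.2) lt).
  by rewrite ltnn.
have f1g1 : (f.1 < g.1)%N by rewrite -rank_lt1.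
split=> // a aA ag1 ag2; rewrite leqNgt; apply/negP => fa.
case: (ltngtP a f.2) => lt.
- have b1 : (a, f.2) \in prs A by rewrite in_prs /= aA f2 lt.
  have b2 : (a, f.2) != f.
    by apply/eqP => E; move: fa; rewrite -E /= ltnn.
  have b3 : (a, f.2) != g by apply: contraNneq ag1 => <-.
  by have := inD _ b1 b2 b3; rewrite rank_lt1 //= ltnNge (ltnW fa).
- have b1 : (f.2, a) \in prs A by rewrite in_prs /= aA f2 lt.
  have b2 : (f.2, a) != f by apply/eqP => E; move: lt; rewrite -E /= ltnn.
  have b3 : (f.2, a) != g by apply/eqP => E; move: lt; rewrite -g2f2 -E /= ltnn.
  have L := inD _ b1 b2 b3; have := ltn_trans L (@rank_lt2 _ f (f.2, a) lt).
  by rewrite ltnn.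
- by case/eqP: ag2; apply/val_inj; rewrite g2f2.
Qed.

Lemma closesP s f g : reflect
  [/\ g \notin dec s, g != f & exists A : {set V}, [/\ #|A| = r, f \in prs A, g \in prs A &
     prs A :\ f :\ g \subset gr s]] (g \in closes s f).
Proof.
rewrite inE; apply: (iffP and3P) => [[gd gf /existsP[A /and4P[/eqP]]]|[gd gf [A []]]].
  by split=> //; exists A.
by move=> cA fA gA sub; split=> //; apply/existsP; exists A; rewrite cA eqxx fA gA.
Qed.

(** The increment of [haz] is paid by the new term m = f of an r-set witnessing that f closes g. The
    old terms cannot decrease: the graph grows and decided weights are fixed. *)
Lemma hazb_step f l s s' : inv (f :: l) s ->
  dec s' = f |: dec s -> gr s \subset gr s' ->
  (forall m, m \in f |: dec s -> wt s' m = wt s m) ->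
  forall g, haz s g + (g \in closes s f)%:R * accept_prob s f <= hazbound s' g.
Proof.
move=> I Ed sG Ew g.
have fd := head_notin_dec I.
pose T A := \sum_(m in prs A :\ g | m \in dec s)
      (prs A :\ g :\ m \subset gr s)%:R * (p * wt s m).
pose T' A := T A + ((f \in prs A :\ g) && (prs A :\ g :\ f \subset gr s))%:R * (p * wt s f).
have mono A : T' A <= \sum_(m in prs A :\ g | m \in dec s')
      (prs A :\ g :\ m \subset gr s')%:R * (p * wt s' m).
  rewrite Ed /T' /T.
  have le1 m : m \in f |: dec s -> (prs A :\ g :\ m \subset gr s)%:R * (p * wt s m) <=
      (prs A :\ g :\ m \subset gr s')%:R * (p * wt s' m).
    move=> md; rewrite (Ew _ md) ler_wpM2r ?(prob_ge0 m I) // ler_nat.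
    case sub: (prs A :\ g :\ m \subset gr s) => //.
    by rewrite (subset_trans sub sG).
  case fA: (f \in prs A :\ g) => /=; last first.
    rewrite mul0r addr0 [leRHS](eq_bigl (fun m => (m \in prs A :\ g) && (m \in dec s))).
      by apply: ler_sum => m /andP[_ md]; apply: le1; rewrite inE md orbT.
    move=> m; rewrite in_setU1; case: eqP => [->|//]; by rewrite fA.
  rewrite [leRHS](bigD1 f) /=; last by rewrite fA setU11.
  rewrite addrC lerD ?le1 ?setU11 //.
  rewrite [leRHS](eq_bigl (fun m => (m \in prs A :\ g) && (m \in dec s))).
    by apply: ler_sum => m /andP[_ md]; apply: le1; rewrite inE md orbT.
  move=> m; rewrite in_setU1; case: (altP (m =P f)) => [->|_] /=.
    by rewrite (negbTE fd) andbF andbF.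
  by rewrite andbT.
apply: (@le_trans _ _ (\sum_(A : {set V} | (#|A| == r) && (g \in prs A)) T' A)); last first.
  by apply: ler_sum => A _; apply: mono.
rewrite big_split /=; apply: lerD; first exact: (inv_hazb I).
case: closesP => [[gd gf [A [cA fA gA sub]]]|_]; last first.
  by rewrite mul0r; apply: sumr_ge0 => A _; rewrite mulr_ge0 ?(prob_ge0 f I).
rewrite mul1r (bigD1 A) /=; last by rewrite cA eqxx gA.
rewrite in_setD1 eq_sym gf fA /=.
have -> : prs A :\ g :\ f \subset gr s.
  by apply: subset_trans sub; apply/subsetP => h; rewrite !in_setD1 andbCA.
rewrite mul1r lerDl; apply: sumr_ge0 => B _; by rewrite mulr_ge0 ?(prob_ge0 f I).
Qed.

(** Same accounting with two r-sets A and B, for g and h. Apart from the ends of g, the vertices of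
    A are at most f.1 < h.1, so h.1 is outside A; and [(f.1, h.1)] is a pair of B other than f and
    h, hence accepted. *)
Lemma haz2b_step f l s s' : inv (f :: l) s ->
  dec s' = f |: dec s -> gr s \subset gr s' ->
  (forall m, m \in f |: dec s -> wt s' m = wt s m) ->
  forall g h, haz2 s g h + ([&& g \in closes s f, h \in closes s f & g != h])%:R
      * accept_prob s f <= haz2bound s' g h.
Proof.
move=> I Ed sG Ew g h.
have fd := head_notin_dec I.
pose c (m : P) := [&& m.1 != g.1 , m.1 != g.2 & (m.1 < h.1)%N].
pose b A m (Gs : {set P}) := (prs A :\ g :\ m \subset Gs) && ((m.1, h.1) \in Gs).
pose T A := \sum_(m in prs A :\ g | (m \in dec s) && c m) (b A m (gr s))%:R * (p * wt s m).
pose T' A := T A + [&& f \in prs A :\ g, c f & b A f (gr s)]%:R * (p * wt s f).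
have mono A : T' A <= \sum_(m in prs A :\ g | (m \in dec s') && c m)
      (b A m (gr s'))%:R * (p * wt s' m).
  rewrite Ed /T' /T.
  have le1 m : m \in f |: dec s -> (b A m (gr s))%:R * (p * wt s m) <=
      (b A m (gr s'))%:R * (p * wt s' m).
    move=> md; rewrite (Ew _ md) ler_wpM2r ?(prob_ge0 m I) // ler_nat.
    case sub: (b A m (gr s)) => //; case/andP: sub => sub e.
    by rewrite /b (subset_trans sub sG) (subsetP sG).
  case fA: ((f \in prs A :\ g) && c f) => /=; last first.
    rewrite andbA fA /= mul0r addr0
      [leRHS](eq_bigl (fun m => (m \in prs A :\ g) && ((m \in dec s) && c m))).
      by apply: ler_sum => m /andP[_ /andP[md _]]; apply: le1; rewrite inE md orbT.
    move=> m; rewrite in_setU1; case: eqP => [->|//] /=.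
    by rewrite fA (negbTE fd) /= andbF.
  rewrite [leRHS](bigD1 f) /=; last by case/andP: fA => -> ->; rewrite setU11.
  case/andP: fA => fA cf; rewrite fA cf.
  rewrite addrC lerD ?le1 ?setU11 //.
  rewrite [leRHS](eq_bigl (fun m => (m \in prs A :\ g) && ((m \in dec s) && c m))).
    by apply: ler_sum => m /andP[_ /andP[md _]]; apply: le1; rewrite inE md orbT.
  move=> m; rewrite in_setU1; case: (altP (m =P f)) => [->|_] /=.
    by rewrite (negbTE fd) andbF andbF.
  by rewrite andbT.
apply: (@le_trans _ _ (\sum_(A : {set V} | [&& #|A| == r, g \in prs A & h.1 \notin A]) T' A));
    last first.
  by apply: ler_sum => A _; apply: mono.
rewrite big_split /=; apply: lerD; first exact: (inv_haz2b I).
case: and3P => [[gc hc gh]|_]; last first.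
  by rewrite mul0r; apply: sumr_ge0 => A _; rewrite mulr_ge0 ?(prob_ge0 f I).
case/closesP: gc => gd gf [A [cA fA gA sub]].
case/closesP: hc => hd hf [B [cB fB hB subB]].
have [g2 f1g1 Aa] := closes_row I cA fA gA gd gf sub.
have [h2 f1h1 Ba] := closes_row I cB fB hB hd hf subB.
have f12 : (f.1 < f.2)%N by move: fA; rewrite in_prs => /and3P[].
have h12 : (h.1 < h.2)%N by move: hB; rewrite in_prs => /and3P[].
have hA : h.1 \notin A.
  apply/negP => hA; have := Aa _ hA; rewrite leqNgt f1h1 /=.
  have hg1 : h.1 != g.1.
    apply: contraNneq gh => E; case: (g) (h) E h2 g2 => [? ?] [? ?] /= -> -> ->.
    by rewrite eqxx.
  have hg2 : h.1 != g.2.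
    by apply/eqP => E; move: h12; rewrite h2 -g2 -E ltnn.
  by move=> /(_ hg1 hg2).
have cf : c f.
  rewrite /c !neq_ltn f1g1 f1h1 andbT /= g2 f12.
  by [].
have eG : (f.1, h.1) \in gr s.
  apply: (subsetP subB); rewrite !in_setD1 in_prs /= f1h1 andbT.
  move: fB hB; rewrite !in_prs => /and3P[-> _ _] /and3P[-> _ _]; rewrite /= andbT.
  apply/andP; split.
    by apply/eqP => E; move: f1h1; rewrite -E /= ltnn.
  by apply/eqP => E; move: h12; rewrite h2 -E /= ltnn.
rewrite mul1r (bigD1 A) /=; last by rewrite cA eqxx gA.
rewrite in_setD1 eq_sym gf fA /= cf /b eG andbT /=.
have -> : prs A :\ g :\ f \subset gr s.
  by apply: subset_trans sub; apply/subsetP => x; rewrite !in_setD1 andbCA.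
rewrite mul1r lerDl; apply: sumr_ge0 => C _; by rewrite mulr_ge0 ?(prob_ge0 f I).
Qed.

Lemma inv_expR_bound (q : R) : 0 <= q -> q <= 1 / 2%:R -> (1 - q)^-1 <= expR (2 * q).
Proof.
move=> q0 q1; apply: le_trans (expR_ge1Dx _).
have h : 0 < 1 - q by lra.
by rewrite -(ler_pM2l h) mulfV ?gt_eqF //; nra.
Qed.

(** Treats both outcomes at once: only weights of closed pairs change, by a factor at most 1 / (1 -
    q), and acceptance enters only through its consequences, a positive probability for f and weight
    0 for the closed pairs. *)
Lemma inv_step f l s s' : inv (f :: l) s -> active s f ->
  dec s' = f |: dec s -> gr s \subset gr s' -> gr s' \subset f |: gr s ->
  (forall g, haz s' g = haz s g + (g \in closes s f)%:R * accept_prob s f) ->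
  (forall g h, haz2 s' g h = haz2 s g h +
     ([&& g \in closes s f, h \in closes s f & g != h])%:R * accept_prob s f) ->
  (forall g, g \notin closes s f -> wt s' g = wt s g) ->
  (forall g, 0 <= wt s' g <= wt s g / (1 - accept_prob s f)) ->
  (f \in gr s' -> 0 < accept_prob s f /\ forall g, g \in closes s f -> wt s' g = 0) ->
  inv l s'.
Proof.
move=> I act Ed sG Gs' Eh Eh2 Ew Ew' Ef.
have fd := head_notin_dec I.
have q0 := prob_ge0 f I; have q12 := prob_le12 f I.
have ql : accept_prob s f <= lam := pwt_le f I.
have q1 : 0 < 1 - accept_prob s f by lra.
case/and3P: act => /forallP aS /forallP aH _.
have fl : f \notin l.
  have := inv_sorted I; rewrite /= (path_sortedE ltn_trans) => /andP[/allP S _].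
  by apply/negP => fl; have := S _ (map_f (@rank n) fl); rewrite ltnn.
have ffix m : m \in f |: dec s -> wt s' m = wt s m.
  rewrite in_setU1 => /orP[/eqP->|md]; apply: Ew; rewrite inE ?eqxx ?andbF //.
  by rewrite md.
have w0 g : wt s g = 0 -> wt s' g = 0.
  move=> E; have := Ew' g; rewrite E mul0r => /andP[a b].
  by apply/eqP; rewrite eq_le a b.
split.
- by have := path_sorted (inv_sorted I).
- move=> d x; rewrite Ed in_setU1 => /orP[/eqP->|dd] xl.
    have := inv_sorted I; rewrite /= (path_sortedE ltn_trans) => /andP[/allP S _].
    by apply: S; apply: map_f.
  by apply: (inv_lt I) => //; rewrite inE xl orbT.
- by move=> g; rewrite (inv_cover I) Ed in_setU1 inE orbCA orbA.
- rewrite Ed; apply: subset_trans Gs' _; apply: setUS; exact: inv_gr I.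
- by move=> g; case/andP: (Ew' g).
- by move=> g; rewrite Eh addr_ge0 ?(inv_haz0 I) // mulr_ge0.
- by move=> g h; rewrite Eh2 addr_ge0 ?(inv_haz20 I) // mulr_ge0.
- move=> g; rewrite Eh; case: (boolP (g \in closes s f)) => gc; last first.
    by rewrite mul0r addr0 (Ew _ gc) (inv_wtle I).
  rewrite mul1r mulrDr expRD; case/andP: (Ew' g) => _ /le_trans; apply.
  apply: ler_pM; rewrite ?(inv_wt0 I) ?(inv_wtle I) ?invr_ge0 ?(ltW q1) //.
  exact: inv_expR_bound.
- move=> g; rewrite Eh lerD //.
  by case: (g \in _); rewrite ?mul1r ?mul0r // ltW // lam0.
- move=> g h; rewrite Eh2 lerD //; first by move/forallP: (aH g); apply.
  by case: [&& _, _ & _]; rewrite ?mul1r ?mul0r // ltW // lam0.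
- move=> A g cA gA; rewrite Ed in_setU1 negb_or => /andP[gf gd] sub.
  case: (boolP (f \in gr s')) => fG; last first.
    apply: w0; apply: (inv_clique I cA gA gd).
    apply/subsetP => x xA; have := subsetP Gs' _ (subsetP sub _ xA).
    rewrite in_setU1 => /orP[/eqP E|//].
    by move: (subsetP sub _ xA); rewrite E (negbTE fG).
  have [qp wC] := Ef fG.
  case: (boolP (f \in prs A)) => fA; last first.
    apply: w0; apply: (inv_clique I cA gA gd).
    apply/subsetP => x xA; have := subsetP Gs' _ (subsetP sub _ xA).
    rewrite in_setU1 => /orP[/eqP E|//].
    by move: xA; rewrite E in_setD1 (negbTE fA) andbF.
  apply: wC; apply/closesP; split=> //; exists A; split=> //.
  apply/subsetP => x; rewrite !in_setD1 => /and3P[xg xf xA].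
  have : x \in gr s' by apply: (subsetP sub); rewrite in_setD1 xg.
  by move=> /(subsetP Gs'); rewrite in_setU1 (negbTE xf).
- move=> A cA; apply/negP => sub.
  case: (boolP (f \in gr s')) => fG; last first.
    case/negP: (inv_free I cA); apply/subsetP => x /(subsetP sub) xG.
    have := subsetP Gs' _ xG; rewrite in_setU1 => /orP[/eqP E|//].
    by move: xG; rewrite E (negbTE fG).
  case: (boolP (f \in prs A)) => fA; last first.
    case/negP: (inv_free I cA); apply/subsetP => x xA.
    have := subsetP Gs' _ (subsetP sub _ xA); rewrite in_setU1 => /orP[/eqP E|//].
    by move: xA; rewrite E (negbTE fA).
  (* If f completed a K_r, its weight would be 0, against its positive acceptance probability. *)
  have [qp _] := Ef fG; move: qp; rewrite /accept_prob (inv_clique I cA fA fd) ?mulr0 ?ltxx //.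
  apply/subsetP => x; rewrite in_setD1 => /andP[xf xA].
  have := subsetP Gs' _ (subsetP sub _ xA); by rewrite in_setU1 (negbTE xf).
- by move=> g; rewrite Eh; apply: (hazb_step I).
- by move=> g h; rewrite Eh2; apply: (haz2b_step I).
- move=> g h gh; rewrite Eh2 (inv_row I gh) add0r.
  case: and3P => [[]|_]; last by rewrite mul0r.
  move=> /closesP[gd gf [A [cA fA gA sub]]] /closesP[hd hf [B [cB fB hB subB]]] _.
  have [g2 _ _] := closes_row I cA fA gA gd gf sub.
  have [h2 _ _] := closes_row I cB fB hB hd hf subB.
  by move: gh; rewrite g2 h2 eqxx.
- by move=> g; rewrite Eh2 (inv_diag I) eqxx !andbF mul0r addr0.
Qed.

Lemma inv_incl f l s : inv (f :: l) s -> active s f -> 0 < accept_prob s f ->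
  inv l (incl s f).
Proof.
move=> I act qp; have q12 := prob_le12 f I.
apply: (inv_step I act) => //=.
- exact: subsetUr.
- by move=> g /negbTE ->.
- move=> g; case: ifP => _; rewrite ?lexx ?(inv_wt0 I) ?divr_ge0 ?(inv_wt0 I) //=; try lra.
  rewrite ler_pdivlMr; last by lra.
  by rewrite ler_piMr ?(inv_wt0 I) //; lra.
- by move=> _; split=> // g ->.
Qed.

Lemma inv_excl f l s : inv (f :: l) s -> active s f -> inv l (excl s f).
Proof.
move=> I act; have q12 := prob_le12 f I; have q0 := prob_ge0 f I.
have fd := head_notin_dec I.
apply: (inv_step I act) => //=.
- exact: subsetUr.
- by move=> g /negbTE ->.
- move=> g; case: ifP => _; rewrite ?lexx ?(inv_wt0 I) ?divr_ge0 ?(inv_wt0 I) //=; try lra.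
  rewrite ler_pdivlMr; last by lra.
  by rewrite ler_piMr ?(inv_wt0 I) //; lra.
- by move=> /(subsetP (inv_gr I)); rewrite (negbTE fd).
Qed.

(** * Expectations over the process *)

Lemma Ex_le_super l s Psi : inv l s ->
  (forall f l s, inv (f :: l) s -> active s f ->
     accept_prob s f * Psi (incl s f) + (1 - accept_prob s f) * Psi (excl s f) <= Psi s) ->
  Ex l s Psi <= Psi s.
Proof.
move=> I step; elim: l s I => [|f l IH] s I //=.
case: ifP => // act; apply: le_trans (step _ _ _ I act).
have q0 := prob_ge0 f I; have q12 := prob_le12 f I.
apply: lerD; last by rewrite ler_wpM2l ?IH //; [lra|exact: inv_excl].
(* The invariant is known to pass to the accepting branch only if this branch has positive
   probability; otherwise its term vanishes. *)
move: q0; rewrite le_eqVlt => /orP[/eqP<-|qp]; first by rewrite !mul0r.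
by rewrite ler_pM2l // IH //; exact: inv_incl.
Qed.

Lemma Ex_mono l s Psi Psi' : inv l s ->
  (forall l s, inv l s -> terminal l s -> Psi s <= Psi' s) ->
  Ex l s Psi <= Ex l s Psi'.
Proof.
move=> I H; elim: l s I => [|f l IH] s I /=; first by apply: (H [::]).
case: ifP => act; last by apply: (H (f :: l)) => //=; rewrite act.
have q0 := prob_ge0 f I; have q12 := prob_le12 f I.
apply: lerD; last by rewrite ler_wpM2l ?IH //; [lra|exact: inv_excl].
move: q0; rewrite le_eqVlt => /orP[/eqP<-|qp]; first by rewrite !mul0r.
by rewrite ler_pM2l // IH //; exact: inv_incl.
Qed.

Lemma Ex_sum (J : finType) (Q : pred J) (F : J -> state -> R) l s :
  Ex l s (fun s => \sum_(j | Q j) F j s) = \sum_(j | Q j) Ex l s (F j).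
Proof.
elim: l s => [|f l IH] s //=; case: ifP => // _.
by rewrite !IH !mulr_sumr -big_split.
Qed.

Lemma eq_Ex (F F' : state -> R) l s : F =1 F' -> Ex l s F = Ex l s F'.
Proof.
by move=> E; elim: l s => [|f l IH] s //=; case: ifP => // _; rewrite !IH.
Qed.

Lemma ExD (F F' : state -> R) l s :
  Ex l s (fun s => F s + F' s) = Ex l s F + Ex l s F'.
Proof.
elim: l s => [|f l IH] s //=; case: ifP => // _.
by rewrite !IH; ring.
Qed.

Lemma ExZ c (F : state -> R) l s : Ex l s (fun s => c * F s) = c * Ex l s F.
Proof.
elim: l s => [|f l IH] s //=; case: ifP => // _.
by rewrite !IH; ring.
Qed.

Lemma Ex_cst c l s : Ex l s (fun=> c) = c.
Proof. by elim: l s => [|f l IH] s //=; case: ifP => // _; rewrite !IH; ring. Qed.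

Definition start : state := State set0 set0 (fun=> 1) (fun=> 0) (fun _ _ => 0).
Definition schedule : seq P :=
  sort (fun g h => (rank g <= rank h)%N) (enum (prs [set: V])).

Lemma inv_start : inv schedule start.
Proof.
have l0 := lam0.
have lein (a b : P) : (0 : R) <= \sum_(A : {set V} | (#|A| == r) && (a \in prs A))
   \sum_(m in prs A :\ a | m \in set0) (prs A :\ a :\ m \subset set0)%:R * (p * 1).
  by apply: sumr_ge0 => A _; apply: sumr_ge0 => m _; rewrite mulr_ge0 // mulr1 ltW.
split=> /=; rewrite ?sub0set //.
- have tr : transitive (fun a b : P => (rank a <= rank b)%N).
    by move=> a b c; apply: leq_trans.
  rewrite ltn_sorted_uniq_leq (map_inj_uniq (@rank_inj n)) sort_uniq enum_uniq /=.
  by rewrite sorted_map; apply: sort_sorted => a b; apply: leq_total.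
- by move=> d x; rewrite in_set0.
- by move=> g; rewrite in_set0 mem_sort mem_enum.
- by move=> g; rewrite mulr0 expR0.
- by move=> g; rewrite addr_ge0 // ltW.
- by move=> g h; rewrite addr_ge0 // ltW.
- move=> A g cA gA _ sub; exfalso.
  have : (2 < 'C(r, 2))%N by rewrite (@leq_trans 'C(3, 2)) // leq_bin2l.
  rewrite -cA -card_prs (cardsD1 g) gA add1n ltnS.
  by move: sub; rewrite subset0 => /eqP->; rewrite cards0.
- move=> A cA; apply/negP; rewrite subset0 -cards_eq0 card_prs cA.
  by rewrite -leqn0 leqNgt bin_gt0 (leq_trans _ r3).
- by move=> g; apply: lein.
- move=> g h; apply: sumr_ge0 => A _; apply: sumr_ge0 => m _.
  by rewrite mulr_ge0 // mulr1 ltW.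
Qed.

(** * Probability that given pairs are all accepted *)

Definition yv s u : R := (u \in gr s)%:R + p * wt s u.

Lemma eq_refl_le (x y : R) : x = y -> x <= y.
Proof. by move=> ->. Qed.

Definition pair_haz U s : R := \sum_(g in U) \sum_(h in U) haz2 s g h.

(* yv s u still counts p * wt s u once u is decided, whence the factor 2. When
   c + 1 pairs of U are closed at once, one of the divisions by 1 - q is
   compensated by the probability of rejection, the other c by pair_haz. *)
Definition spread_pot U s : R :=
  (\prod_(u in U) yv s u) * 2 ^+ #|U :\: dec s| * expR (- pair_haz U s).

Lemma yv_ge0 l s u : inv l s -> 0 <= yv s u.
Proof. by move=> I; rewrite addr_ge0 ?ler0n // (prob_ge0 u I). Qed.

Lemma pair_count U (C : {set P}) :
  \sum_(g in U) \sum_(h in U) ([&& g \in C, h \in C & g != h])%:R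
   = (#|U :&: C| * (#|U :&: C|).-1)%:R :> R.
Proof.
transitivity (\sum_(g in U :&: C) (#|U :&: C|.-1)%:R : R).
  rewrite [RHS](eq_bigl (fun g => (g \in U) && (g \in C))); last by move=> g; rewrite inE.
  rewrite [RHS]big_mkcondr /=; apply: eq_bigr => g gU; case: ifP => gC; last first.
    by apply: big1 => h _.
  have -> : #|U :&: C|.-1 = #|[set h in U | (h \in C) && (g != h)]|.
    rewrite (cardsD1 g) !inE gU gC /=; apply: eq_card => h.
    by rewrite !inE eq_sym; case: (g == h); rewrite ?andbF ?andbT.
  by rewrite -sum1dep_card natr_sum big_mkcondr; apply: eq_bigr => h _; case: ifP.
by rewrite sumr_const natrM mulr_natl.
Qed.

Lemma pair_haz_step U s s' f :
  (forall g h, haz2 s' g h = haz2 s g h +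
     ([&& g \in closes s f, h \in closes s f & g != h])%:R * accept_prob s f) ->
  pair_haz U s' = pair_haz U s +
    accept_prob s f * (#|U :&: closes s f| * (#|U :&: closes s f|).-1)%:R.
Proof.
move=> E; rewrite -pair_count /pair_haz mulr_sumr -big_split /=.
apply: eq_bigr => g _; rewrite mulr_sumr -big_split /=; apply: eq_bigr => h _.
by rewrite E [in RHS]mulrC.
Qed.

(** One factor 1 / (1 - q) cancels; the other c cost at most e^(2 q c), and 2 c <= (c + 1) c as soon
    as c >= 1. *)
Lemma closing_factor (q : R) c : 0 <= q -> q <= 1 / 2%:R ->
  (1 - q) * ((1 - q)^-1) ^+ c.+1 * expR (- (q * (c.+1 * c)%:R)) <= 1.
Proof.
move=> q0 q1; have h : 0 < 1 - q by lra.
rewrite exprS mulrA mulfV ?gt_eqF // mul1r expRN ler_pdivrMr ?expR_gt0 // mul1r.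
apply: (@le_trans _ _ (expR (2 * q) ^+ c)).
  by apply: lerXn2r; rewrite ?nnegrE ?invr_ge0 ?expR_ge0 ?(ltW h) // inv_expR_bound.
rewrite -expRM_natl ler_expR.
case: c => [|c]; first by rewrite mul0r muln0 mulr0.
rewrite mulrA mulrC ler_wpM2l // natrM mulrC ler_wpM2r ?ler0n // ler_nat //.
Qed.

Lemma spread_step U f l s : inv (f :: l) s -> active s f ->
  accept_prob s f * spread_pot U (incl s f) +
  (1 - accept_prob s f) * spread_pot U (excl s f) <= spread_pot U s.
Proof.
move=> I act; have q0 := prob_ge0 f I; have q12 := prob_le12 f I.
have fd := head_notin_dec I.
have fG : f \notin gr s by apply: contra fd => /(subsetP (inv_gr I)).
have fC : f \notin closes s f by rewrite inE eqxx andbF.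
have CG u : u \in closes s f -> u \notin gr s.
  by case/closesP=> ud _ _; apply: contra ud => /(subsetP (inv_gr I)).
rewrite /spread_pot (@pair_haz_step _ s (incl s f) f) // (@pair_haz_step _ s (excl s f) f) //=.
set q := accept_prob s f; set C := closes s f.
set E0 := pair_haz U s; set N := #|U :\: (f |: dec s)|.
have EN : #|U :\: dec s| = ((f \in U) + N)%N.
  rewrite (cardsD1 f) in_setD fd /= /N; congr (_ + _)%N; apply: eq_card => x.
  by rewrite !inE negb_or andbA.
have Pex : \prod_(u in U) yv (excl s f) u =
    (\prod_(u in U) yv s u) * ((1 - q)^-1) ^+ #|U :&: C|.
  have -> : ((1 - q)^-1) ^+ #|U :&: C| = \prod_(u in U) (if u \in C then (1 - q)^-1 else 1).
    rewrite -big_mkcondr prodr_const; congr (_ ^+ _).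
    by apply: eq_card => u; rewrite in_setI.
  rewrite -big_split /=; apply: eq_bigr => u _; rewrite /yv /=.
  case: ifP => uC; last by rewrite mulr1.
  by rewrite (negbTE (CG _ uC)) !add0r mulrA.
have P0 : 0 <= \prod_(u in U) yv s u by apply: prodr_ge0 => u _; apply: yv_ge0 I.
case: (posnP #|U :&: C|) => [c0|cp].
  have UC u : u \in U -> u \notin C.
    move=> uU; apply/negP => uC; move/eqP: c0; rewrite cards_eq0 => /eqP c0.
    by have := in_set0 u; rewrite -c0 in_setI uU uC.
  rewrite Pex c0 mul0n mulr0 addr0 expr0 mulr1.
  have Ein : \prod_(u in U :\ f) yv (incl s f) u = \prod_(u in U :\ f) yv s u.
    apply: eq_bigr => u; rewrite in_setD1 => /andP[uf uU]; rewrite /yv /=.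
    by rewrite in_setU1 (negbTE uf) (negbTE (UC _ uU)).
  case fU: (f \in U); last first.
    have EU : U :\ f = U.
      by apply/setP => u; rewrite in_setD1; case: eqP => // ->; rewrite fU.
    rewrite EU in Ein; rewrite Ein EN fU add0n; apply: eq_refl_le; ring.
  (* At f, [yv] goes from q to 1 + q or stays q, with mean q (1 + q) + (1 - q) q = 2 q: the factor 2
     pays exactly. *)
  rewrite (big_setD1 f fU) [in X in _ <= X](big_setD1 f fU) /=.
  rewrite [in X in _ + X](big_setD1 f fU) /= Ein EN fU.
  rewrite /yv /= setU11 (negbTE fC) (negbTE fG) add1n exprS.
  rewrite -/(accept_prob s f) -/q.
  rewrite (_ : true%:R = 1 :> R) // (_ : false%:R = 0 :> R) //.
  set Y := \prod_(u in U :\ f) _.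
  by apply: eq_refl_le; ring.
(* Some pair of U is closed: acceptance annihilates the product, so only rejection contributes. *)
have [u] : exists u, u \in U :&: C by apply/card_gt0P.
rewrite in_setI => /andP[uU uC].
have -> : \prod_(u in U) yv (incl s f) u = 0.
  rewrite (bigD1 u) //= /yv /= in_setU1 uC (negbTE (CG _ uC)).
  have -> : (u == f) = false by apply/negbTE; case/closesP: uC.
  by rewrite mulr0 addr0 mul0r.
rewrite !mul0r mulr0 add0r Pex opprD expRD.
case: #|U :&: C| cp => // c _.
have K := closing_factor c q0 q12.
rewrite -/q in K.
set X := \prod_(u in U) yv s u in P0 *.
have -> : (1 - q) * (X * (1 - q)^-1 ^+ c.+1 * 2 ^+ N *
   (expR (- E0) * expR (- (q * (c.+1 * c.+1.-1)%:R)))) =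
   (X * 2 ^+ N * expR (- E0)) * ((1 - q) * (1 - q)^-1 ^+ c.+1 * expR (- (q * (c.+1 * c)%:R))).
  by rewrite /=; ring.
apply: (@le_trans _ _ (X * 2 ^+ N * expR (- E0))).
  by rewrite ler_piMr // !mulr_ge0 ?expR_ge0 ?exprn_ge0.
rewrite ler_wpM2r ?expR_ge0 // ler_wpM2l // ler_weXn2l ?EN ?leq_addl //.
by rewrite ler1n.
Qed.

Lemma spread_bound U :
  Ex schedule start (spread_pot U) <= (2 * p) ^+ #|U|.
Proof.
apply: le_trans (Ex_le_super inv_start (spread_step U)) _.
have Z : pair_haz U start = 0 by apply: big1 => g _; apply: big1.
rewrite /spread_pot Z oppr0 expR0 mulr1 /= setD0.
rewrite (eq_bigr (fun=> p)); last by move=> u _; rewrite /yv /= in_set0 add0r mulr1.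
by rewrite prodr_const mulrC exprMn.
Qed.

(** Trades the correction by [pair_haz] for a constant: the invariant bounds every [haz2] by eta +
    lam, and there are at most N^2 terms. *)
Lemma yv_spread U N : (#|U| <= N)%N ->
  Ex schedule start (fun s => \prod_(u in U) yv s u) <=
    (2 * p) ^+ #|U| * expR ((N ^ 2)%:R * (eta + lam)).
Proof.
move=> UB; rewrite mulrC -ler_pdivrMl ?expR_gt0 //.
apply: le_trans (spread_bound U); rewrite -ExZ; apply: (Ex_mono inv_start) => l s I _.
rewrite /spread_pot -expRN mulrC ler_pM ?expR_ge0 ?prodr_ge0 //.
- by move=> u _; apply: yv_ge0 I.
- rewrite ler_peMr ?prodr_ge0 //; first by move=> u _; apply: yv_ge0 I.
  by rewrite exprn_ege1 // ler1n.
rewrite ler_expR lerN2 /pair_haz.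
have el : 0 <= eta + lam by rewrite addr_ge0 // ltW // lam0.
apply: (@le_trans _ _ (\sum_(g in U) \sum_(h in U) (eta + lam))).
  by apply: ler_sum => g _; apply: ler_sum => h _; apply: (inv_haz2le I).
rewrite !sumr_const -mulrnA mulr_natl ler_wpMn2l //.
by rewrite -mulnn leq_mul.
Qed.

(** * Moments of the number of nearly complete sets *)

Lemma prodr_ge1 (J : finType) (Q : pred J) (F : J -> R) :
  (forall i, Q i -> 1 <= F i) -> 1 <= \prod_(i | Q i) F i.
Proof.
by move=> H; apply: (big_ind (fun x => 1 <= x)) => // x y x1 y1; apply: mulr_ege1.
Qed.

(** Common form of the terms of [hazbound], of [haz2bound] and of the sum of closed weights. *)
Definition item_val Q m s : R := (Q :\ m \subset gr s)%:R * (p * wt s m).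

Lemma item_val_ge0 l s Q m : inv l s -> 0 <= item_val Q m s.
Proof. by move=> I; rewrite mulr_ge0 ?ler0n // (prob_ge0 m I). Qed.

(** When the value is nonzero, [yv] is at least 1 on Q except perhaps at m, where it is at least p
    times the weight. The factors of Q outside U thus absorb the value; if there are none, only the
    bound [lam] is left. *)
Lemma item_mul l s U Q m : inv l s -> m \in Q ->
  (\prod_(u in U) yv s u) * item_val Q m s <=
  if Q \subset U then lam * \prod_(u in U) yv s u else \prod_(u in U :|: Q) yv s u.
Proof.
move=> I mQ.
have y0 u : 0 <= yv s u by apply: yv_ge0 I.
have P0 (W : {set P}) : 0 <= \prod_(u in W) yv s u by apply: prodr_ge0.
have vl : item_val Q m s <= lam.
  rewrite /item_val; case: (_ \subset _); rewrite ?mul1r ?mul0r ?(ltW lam0) //.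
  exact: pwt_le I.
case: ifP => [_|/negbT nQU]; first by rewrite mulrC ler_wpM2r.
have -> : \prod_(u in U :|: Q) yv s u =
    (\prod_(u in U) yv s u) * \prod_(u in Q :\: U) yv s u.
  by rewrite [LHS](big_setID U) /= setUK setDUl setDv set0U.
rewrite ler_wpM2l //.
rewrite /item_val; case: (boolP (Q :\ m \subset gr s)) => [/subsetP sub|_]; last first.
  by rewrite mul0r.
rewrite mul1r.
have y1 u : u \in Q :\ m -> 1 <= yv s u.
  by move=> /sub uG; rewrite /yv uG lerDl (prob_ge0 u I).
case: (boolP (m \in U)) => mU; last first.
  rewrite (bigD1 m) /=; last by rewrite inE mU.
  apply: le_trans (_ : yv s m <= _); first by rewrite lerDr ler0n.
  rewrite ler_peMr //; apply: prodr_ge1 => u /andP[]; rewrite in_setD => /andP[_ uQ] um.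
  by rewrite y1 // in_setD1 um.
apply: le_trans (_ : 1 <= _).
  by apply: le_trans (pwt_le m I) _; apply: le_trans lam12 _; lra.
apply: prodr_ge1 => u; rewrite in_setD => /andP[uU uQ].
by rewrite y1 // in_setD1 uQ andbT; apply: contraNneq uU => ->.
Qed.

(* Bound for the factor gained by the expectation of \prod_(u in U) yv s u when
   it is multiplied by item_val Q m. *)
Definition item_cost U Q : R := if Q \subset U then lam else (2 * p) ^+ #|Q :\: U|.

(** The power is expanded one factor at a time: choosing an item enlarges U by at most h pairs, so
    the first-moment bound M is required uniformly in U up to size N. *)
Lemma moment_bound (J : finType) (pj : pred J) (Qs : J -> {set P}) (ms : J -> P)
    (h N : nat) (M : R) :
  (forall j, pj j -> ms j \in Qs j) -> (forall j, pj j -> (#|Qs j| <= h)%N) ->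
  (forall U, (#|U| <= N)%N -> \sum_(j | pj j) item_cost U (Qs j) <= M) ->
  forall b U, (#|U| + b * h <= N)%N ->
  Ex schedule start (fun s => (\prod_(u in U) yv s u) *
      (\sum_(j | pj j) item_val (Qs j) (ms j) s) ^+ b) <=
   (2 * p) ^+ #|U| * M ^+ b * expR ((N ^ 2)%:R * (eta + lam)).
Proof.
move=> Hm Hh HM.
have p20 : 0 <= 2 * p by rewrite mulr_ge0 // ltW.
have c0 U j : 0 <= item_cost U (Qs j).
  by rewrite /item_cost; case: ifP => _; rewrite ?exprn_ge0 // ltW // lam0.
have M0 : 0 <= M.
  by apply: le_trans (HM set0 _); rewrite ?cards0 //; apply: sumr_ge0 => j _.
set D := expR _.
have D0 : 0 <= D := expR_ge0 _.
elim=> [|b IH] U HU.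
  rewrite mul0n addn0 in HU; rewrite expr0 mulr1.
  rewrite (@eq_Ex _ (fun s => \prod_(u in U) yv s u)); last by move=> s; rewrite expr0 mulr1.
  exact: yv_spread.
have UN : (#|U| <= N)%N by apply: leq_trans HU; apply: leq_addr.
pose T s := \sum_(j | pj j) item_val (Qs j) (ms j) s.
pose F j s := (if Qs j \subset U then lam * \prod_(u in U) yv s u
               else \prod_(u in U :|: Qs j) yv s u) * T s ^+ b.
apply: (@le_trans _ _ (Ex schedule start (fun s => \sum_(j | pj j) F j s))).
  apply: (Ex_mono inv_start) => l s I _; rewrite exprS mulrA mulr_sumr mulr_suml.
  apply: ler_sum => j pjj; rewrite /F ler_wpM2r ?exprn_ge0 ?sumr_ge0 //.
    by move=> i _; apply: item_val_ge0 I.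
  exact: item_mul I (Hm _ pjj).
rewrite Ex_sum.
apply: (@le_trans _ _ (\sum_(j | pj j) item_cost U (Qs j) * ((2 * p) ^+ #|U| * M ^+ b * D))).
  apply: ler_sum => j pjj; rewrite /F /item_cost.
  case: ifP => QU.
    rewrite (@eq_Ex _ (fun s => lam * ((\prod_(u in U) yv s u) * T s ^+ b))); last first.
      by move=> s; rewrite mulrA.
    rewrite ExZ ler_wpM2l ?(ltW lam0) // IH //.
    by apply: leq_trans HU; rewrite leq_add2l leq_mul2r leqnSn orbT.
  apply: le_trans (IH _ _) _.
    rewrite (leq_trans _ HU) // mulSn addnA leq_add2r.
    by rewrite (leq_trans (leq_card_setU _ _)) // leq_add2l Hh.
  have -> : #|U :|: Qs j| = (#|Qs j :\: U| + #|U|)%N.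
    by rewrite -(cardsID U) setUK setDUl setDv set0U addnC.
  by rewrite exprD !mulrA.
rewrite -mulr_suml [leLHS]mulrC exprSr.
rewrite [leRHS](_ : _ = (2 * p) ^+ #|U| * M ^+ b * D * M); last by ring.
by rewrite ler_wpM2l ?HM // !mulr_ge0 ?exprn_ge0.
Qed.

(** * Probability that a set of pairs meets no accepted pair *)

(** The exponent takes the values x and - x q / (1 - q) with mean 0, so only a second-order error is
    left. *)
Lemma hit_scalar (q x : R) : 0 <= q -> q <= 1 / 2%:R -> 0 <= x ->
  q * expR x + (1 - q) * expR (- (x * q / (1 - q))) <= expR (2 * q * x ^+ 2 * expR x).
Proof.
move=> q0 q1 x0; apply: le_trans (expR_ge1Dx _).
have h : 0 < 1 - q by lra.
(* Two uses of e^x <= 1 + x e^x. *)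
have e1 : expR x <= 1 + x + x ^+ 2 * expR x.
  have a : (1 - x) * expR x <= 1.
    by rewrite -ler_pdivlMr ?expR_gt0 // div1r -expRN; apply: expR_ge1Dx.
  have := expR_ge0 x; nra.
set t := x * q / (1 - q).
have t0 : 0 <= t by rewrite divr_ge0 ?mulr_ge0 // ltW.
have e2 : expR (- t) <= 1 - t + t ^+ 2.
  have := expR_ge1Dx t; rewrite expRN => a.
  have t1 : 0 < 1 + t by lra.
  apply: (@le_trans _ _ (1 + t)^-1); first by rewrite lef_pV2 ?posrE ?expR_gt0.
  by rewrite -div1r ler_pdivrMr //; nra.
have tq : (1 - q) * t = x * q by rewrite /t; field; lra.
have tx : t <= 2 * q * x.
  have a : 0 <= x * q * (1 - 2 * q) by rewrite !mulr_ge0 //; lra.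
  by rewrite /t ler_pdivrMr //; lra.
have e3 : (1 - q) * t ^+ 2 <= q * x ^+ 2 .
  have -> : (1 - q) * t ^+ 2 = x * q * t by rewrite -tq; ring.
  apply: (@le_trans _ _ (x * q * (2 * q * x))); first by rewrite ler_wpM2l // mulr_ge0.
  have a : 0 <= q * x ^+ 2 * (1 - 2 * q) by rewrite !mulr_ge0 ?sqr_ge0 //; lra.
  lra.
have ex1 : 1 <= expR x by apply: le_trans (expR_ge1Dx x); lra.
have e4 : q * x ^+ 2 <= q * x ^+ 2 * expR x by rewrite ler_peMr // mulr_ge0 ?sqr_ge0.
have e5 : q * expR x <= q * (1 + x + x ^+ 2 * expR x) by rewrite ler_wpM2l.
have e6 : (1 - q) * expR (- t) <= (1 - q) * (1 - t + t ^+ 2) by rewrite ler_wpM2l // ltW.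
lra.
Qed.

(** If f closes c pairs of F, their total acceptance probability x is at most lam * c, and at most
    sigma while active. The error 2 q x^2 e^x is then at most [hit_rate * (q * c ^ 2)], and c^2 = c
    + c (c - 1) splits into the increments of [haz] and [pair_haz]. *)
Definition hit_rate : R := 2 * lam ^+ 2 * expR sigma.

(* The haz terms compensate the second-order error in the exponential moment of
   the weight change at each step. *)
Definition hit_pot F s : R :=
  [disjoint F & gr s]%:R * expR (- (p * \sum_(g in F :\: dec s) wt s g)
     - hit_rate * (\sum_(g in F) haz s g + pair_haz F s)).

Lemma hit_step F f l s : inv (f :: l) s -> active s f ->
  accept_prob s f * hit_pot F (incl s f) +
  (1 - accept_prob s f) * hit_pot F (excl s f) <= hit_pot F s.
Proof.
move=> I act; have q0 := prob_ge0 f I; have q12 := prob_le12 f I.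
have fd := head_notin_dec I.
have fG : f \notin gr s by apply: contra fd => /(subsetP (inv_gr I)).
have fC : f \notin closes s f by rewrite inE eqxx andbF.
have l0 := lam0.
have hr0 : 0 <= hit_rate.
  by apply: mulr_ge0 (expR_ge0 _); apply: mulr_ge0 (sqr_ge0 _).
rewrite /hit_pot (@pair_haz_step _ s (incl s f) f) // (@pair_haz_step _ s (excl s f) f) //=.
set q := accept_prob s f in q0 q12 *; set C := closes s f in fC *.
have h1q : 0 < 1 - q by lra.
case: (boolP [disjoint F & gr s]) => dFG; last first.
  have -> : [disjoint F & f |: gr s] = false.
    apply: contraNF dFG => /disjointWr; apply.
    by apply/subsetP => x; rewrite in_setU1 orbC => ->.
  by rewrite !mul0r !mulr0 addr0.
rewrite (_ : true%:R = 1 :> R) // !mul1r.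
pose D := \sum_(g in F :&: C) wt s g.
pose W := \sum_(g in F :\: (f |: dec s)) wt s g.
pose Z := hit_rate * (\sum_(g in F) haz s g + pair_haz F s).
pose c := #|F :&: C|.
have Wle g : 0 <= wt s g := inv_wt0 I g.
have D0 : 0 <= D by apply: sumr_ge0.
pose x := p * D.
have x0 : 0 <= x by rewrite mulr_ge0 // ltW.
have xs : x <= sigma.
  case/and3P: act => _ _; apply: le_trans; rewrite /x /D mulr_sumr.
  rewrite [leRHS](big_setID F) /= setIC lerDl; apply: sumr_ge0 => g _.
  exact: prob_ge0 I.
have xc : x <= lam * c%:R.
  rewrite /x /D mulr_sumr mulr_natr -sumr_const; apply: ler_sum => g _.
  exact: pwt_le I.
have FC : F :&: C \subset F :\: (f |: dec s).
  apply/subsetP => g; rewrite in_setI in_setD in_setU1 negb_or => /andP[-> /closesP[-> -> _]] //.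
have WDC : W = D + \sum_(g in (F :\: (f |: dec s)) :\: C) wt s g.
  rewrite /W (big_setID C) /=; congr (_ + _); apply: eq_bigl => g.
  rewrite !in_setI.
  case gC: (g \in C); rewrite ?andbF ?andbT //.
  apply/idP/idP; first by rewrite in_setD => /andP[].
  by move=> gF; apply: (subsetP FC); rewrite in_setI gF.
have Win : \sum_(g in F :\: (f |: dec s)) (if g \in C then 0 else wt s g) = W - D.
  rewrite WDC addrC addKr (big_setID C) /= big1 ?add0r; last first.
    by move=> g; rewrite in_setI => /andP[_ ->].
  by apply: eq_bigr => g; rewrite in_setD => /andP[/negbTE ->].
have Wex : \sum_(g in F :\: (f |: dec s)) (if g \in C then wt s g / (1 - q) else wt s g)
    = W + D * q / (1 - q).
  have h : 1 - q != 0 by rewrite gt_eqF //; lra.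
  transitivity (D / (1 - q) + \sum_(g in (F :\: (f |: dec s)) :\: C) wt s g).
    rewrite (big_setID C) /=; congr (_ + _); last first.
      by apply: eq_bigr => g; rewrite in_setD => /andP[/negbTE ->].
    rewrite /D mulr_suml; apply: eq_big => [g|g]; last by rewrite in_setI => /andP[_ ->].
    rewrite !in_setI.
    case gC: (g \in C); rewrite ?andbF ?andbT //.
    apply/idP/idP; first by rewrite in_setD => /andP[].
    by move=> gF; apply: (subsetP FC); rewrite in_setI gF.
  by rewrite WDC; field.
have Zs : hit_rate * (\sum_(g in F) (haz s g + (g \in C)%:R * q) +
     (pair_haz F s + q * (c * c.-1)%:R)) = Z + hit_rate * (q * (c ^ 2)%:R).
  have -> : \sum_(g in F) (haz s g + (g \in C)%:R * q) = \sum_(g in F) haz s g + q * c%:R.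
    rewrite big_split /=; congr (_ + _); rewrite -mulr_suml mulrC; congr (_ * _).
    rewrite /c -sum1_card natr_sum [RHS](eq_bigl (fun g => (g \in F) && (g \in C))); last first.
      by move=> g; rewrite in_setI.
    by rewrite [RHS]big_mkcondr; apply: eq_bigr => g _; case: (g \in C).
  have -> : (c ^ 2)%:R = c%:R + (c * c.-1)%:R :> R.
    by rewrite -natrD; congr _%:R; case: (c) => // k; rewrite -mulnn mulnS.
  by rewrite /Z; ring.
rewrite Win Wex Zs -/Z.
have qc : 2 * q * x ^+ 2 * expR x <= hit_rate * (q * (c ^ 2)%:R).
  rewrite [leRHS](_ : _ = 2 * q * (lam * c%:R) ^+ 2 * expR sigma); last first.
    by rewrite /hit_rate natrX; ring.
  have q20 : 0 <= 2 * q by rewrite mulr_ge0.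
  apply: ler_pM; [by apply: mulr_ge0 (sqr_ge0 _)|exact: expR_ge0| |by rewrite ler_expR].
  by rewrite ler_wpM2l // lerXn2r // nnegrE (mulr_ge0 (ltW l0) (ler0n _ _)).
have key := le_trans (hit_scalar q0 q12 x0) (_ : _ <= expR (hit_rate * (q * (c ^ 2)%:R))).
rewrite ler_expR in key; have {}key := key qc.
(* If f is in F, acceptance makes the potential vanish, and the rejection probability 1 - q <=
   e^(-q) replaces the term of f in the exponent. Otherwise only the fluctuation of the closed
   weights matters. *)
case: (boolP (f \in F)) => fF.
  have -> : [disjoint F & f |: gr s] = false.
    apply/negbTE/negP => /disjointFr /(_ fF); by rewrite setU11.
  rewrite mul0r mulr0 add0r.
  have -> : \sum_(g in F :\: dec s) wt s g = wt s f + W.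
    rewrite (bigD1 f) /=; last by rewrite in_setD fd.
    congr (_ + _); apply: eq_bigl => g; rewrite !in_setD in_setU1 negb_or andbC.
    by rewrite andbA.
  apply: (@le_trans _ _ (expR (- q) * expR (- (p * W) - Z))).
    apply: ler_pM; rewrite ?expR_ge0 //; [exact: ltW|exact: expR_ge1Dx|].
    rewrite ler_expR lerB // ?lerN2 ?ler_wpM2l ?(ltW p0) // ?lerDl.
      by rewrite divr_ge0 ?mulr_ge0 // ltW.
    by rewrite mulr_ge0 // mulr_ge0.
  by rewrite -expRD ler_expR /q /accept_prob; apply: eq_refl_le; ring.
have -> : F :\: dec s = F :\: (f |: dec s).
  apply/setP => g; rewrite !in_setD in_setU1; case: (altP (g =P f)) => [->|//].
  by rewrite (negbTE fF) !andbF.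
have -> : [disjoint F & f |: gr s] = true.
  apply/pred0P => g /=; rewrite in_setU1; case: (altP (g =P f)) => [->|_].
    by rewrite (negbTE fF).
  by move/pred0P: dFG => /(_ g).
rewrite (_ : true%:R = 1 :> R) // !mul1r -/W.
set K := hit_rate * (q * (c ^ 2)%:R) in key *.
have -> : - (p * (W - D)) - (Z + K) = (- (p * W) - Z) + (x - K) by rewrite /x; ring.
have -> : - (p * (W + D * q / (1 - q))) - (Z + K) =
   (- (p * W) - Z) + (- (x * q / (1 - q)) - K).
  by rewrite /x; field; rewrite gt_eqF //; lra.
move: (- (p * W) - Z) => A0; rewrite !expRD.
have -> : q * (expR A0 * (expR x * expR (- K))) +
   (1 - q) * (expR A0 * (expR (- (x * q / (1 - q))) * expR (- K))) =
   expR A0 * ((q * expR x + (1 - q) * expR (- (x * q / (1 - q)))) * expR (- K)) by ring.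
by rewrite ler_piMr ?expR_ge0 // (expRN K) ler_pdivrMr ?expR_gt0 // mul1r.
Qed.

Lemma hit_bound F : F \subset prs setT ->
  Ex schedule start (hit_pot F) <= expR (- (p * #|F|%:R)).
Proof.
move=> FT; apply: le_trans (Ex_le_super inv_start (hit_step F)) _.
have Z : pair_haz F start = 0 by apply: big1 => g _; apply: big1.
rewrite /hit_pot Z /= setD0 big1_eq addr0 mulr0 subr0.
rewrite sumr_const; case: [disjoint _ & _]; rewrite ?mul1r ?mul0r ?expR_ge0 //.
Qed.

(** * Counting r-sets by their overlap with given vertices *)

Lemma ffact_le_exp m k : (m ^_ k <= m ^ k)%N.
Proof.
elim: k => [|k IH] //; by rewrite ffactnSr expnSr leq_mul // leq_subr.
Qed.

Lemma bin_le_exp m k : ('C(m, k) <= m ^ k)%N.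
Proof.
by apply: leq_trans (ffact_le_exp m k); rewrite -bin_ffact leq_pmulr // fact_gt0.
Qed.

(** Such an A is determined by its i - 2 further vertices in Y and its r - i vertices outside. *)
Lemma count_cliques (Y : {set V}) g i : g.1 \in Y -> g.2 \in Y -> g.1 != g.2 ->
  (#|[set A : {set V} | [&& #|A| == r, g.1 \in A, g.2 \in A & #|A :&: Y| == i]]|
     <= #|Y| ^ (i - 2) * n ^ (r - i))%N.
Proof.
move=> aY bY ab.
pose m (A : {set V}) := ((A :&: Y) :\ g.1 :\ g.2, A :\: Y).
pose S1 := [set B : {set V} | B \subset Y & #|B| == (i - 2)%N].
pose S2 := [set B : {set V} | B \subset setT & #|B| == (r - i)%N].
apply: (@leq_trans #|setX S1 S2|); last first.
  rewrite cardsX !cards_draws cardsT card_ord.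
  by apply: leq_mul; apply: bin_le_exp.
rewrite -(card_in_imset (f := m)).
  apply: subset_leq_card; apply/subsetP => X /imsetP[A]; rewrite inE => /and4P[/eqP cA aA bA /eqP cAY] ->.
  have h1 : g.1 \in A :&: Y by rewrite inE aA.
  have h2 : g.2 \in (A :&: Y) :\ g.1 by rewrite !inE eq_sym ab bA.
  rewrite in_setX; apply/andP; split; rewrite inE /=; last first.
    by rewrite subsetT cardsD cA cAY eqxx.
  apply/andP; split.
  - by apply: subset_trans (subsetDl _ _) _; apply: subset_trans (subsetDl _ _) (subsetIr _ _).
  - move: (cardsD1 g.1 (A :&: Y)) (cardsD1 g.2 ((A :&: Y) :\ g.1)); rewrite h1 h2 cAY => -> ->.
    by rewrite !add1n subSS subSS subn0.
move=> A B; rewrite !inE => /and4P[_ aA bA _] /and4P[_ aB bB _] [e1 e2].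
apply/setP => x.
case: (boolP (x \in Y)) => xY; last first.
  by move/setP: e2 => /(_ x); rewrite !inE xY.
case: (altP (x =P g.1)) => [->|x1]; first by rewrite aA aB.
case: (altP (x =P g.2)) => [->|x2]; first by rewrite bA bB.
by move/setP: e1 => /(_ x); rewrite !inE x1 x2 xY /= !andbT.
Qed.

(* The cost of an r-set A meeting the ends of U in i vertices; in clique_cost2 one
   more pair has to be accepted. *)
Definition clique_cost i : R :=
  if (i < r)%N then (2 * p) ^+ ('C(r, 2) - 'C(i, 2)) else lam.

Definition clique_cost2 i : R :=
  if i == 2 then 2 * p * clique_cost i else clique_cost i.

(** Bounds the total cost of the r-sets through a given pair when at most y vertices are already
    touched: i is the overlap with them, and the factor ['C(r, 2)] accounts for the choice of m. *)
Definition clique_sum (c : nat -> R) (y : nat) : R :=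
  'C(r, 2)%:R * \sum_(2 <= i < r.+1) (y ^ (i - 2) * n ^ (r - i))%:R * c i.

Lemma clique_sum_bound (c : nat -> R) (Y : {set V}) g y :
  (forall i, 0 <= c i) -> (#|Y| <= y)%N ->
  g.1 \in Y -> g.2 \in Y -> g.1 != g.2 ->
  \sum_(A : {set V} | (#|A| == r) && (g \in prs A)) c #|A :&: Y| <=
  \sum_(2 <= i < r.+1) (y ^ (i - 2) * n ^ (r - i))%:R * c i.
Proof.
move=> c0 Yy g1 g2 g12.
pose Ai i (A : {set V}) := [&& #|A| == r, g.1 \in A, g.2 \in A & #|A :&: Y| == i].
apply: (@le_trans _ _ (\sum_(A : {set V}) \sum_(2 <= i < r.+1) (Ai i A)%:R * c i)).
  rewrite big_mkcond; apply: ler_sum => A _.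
  case: ifP => [/andP[cA]|_]; last first.
    by apply: sumr_ge0 => i _; rewrite mulr_ge0.
  rewrite in_prs => /and3P[a1 a2 _].
  have i2 : (2 <= #|A :&: Y|)%N.
    rewrite -(_ : #|[set g.1; g.2]| = 2%N); last by rewrite cards2 g12.
    apply: subset_leq_card; apply/subsetP => x; rewrite !inE.
    by move=> /orP[] /eqP ->; rewrite ?a1 ?a2 ?g1 ?g2.
  have ir : (#|A :&: Y| < r.+1)%N.
    by rewrite ltnS -(eqP cA) subset_leq_card // subsetIl.
  rewrite (bigD1_seq #|A :&: Y|) ?iota_uniq ?mem_index_iota ?i2 //=.
  rewrite /Ai cA a1 a2 eqxx mul1r lerDl.
  by apply: sumr_ge0 => i _; rewrite mulr_ge0.
rewrite exchange_big /=; apply: ler_sum_nat => i _.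
rewrite -mulr_suml ler_wpM2r // -natr_sum ler_nat.
have -> : (\sum_(A : {set V}) Ai i A)%N = #|[set A : {set V} | Ai i A]|.
  by rewrite -sum1dep_card [RHS]big_mkcond; apply: eq_bigr => A _; case: (Ai i A).
apply: leq_trans (count_cliques i g1 g2 g12) _.
by apply: leq_mul => //; case: (i - 2)%N => // j; rewrite leq_exp2r.
Qed.

Definition ends U : {set V} := [set g.1 | g in U] :|: [set g.2 | g in U].

Lemma card_ends U : (#|ends U| <= 2 * #|U|)%N.
Proof.
rewrite mul2n -addnn; apply: leq_trans (leq_card_setU _ _) _.
by apply: leq_add; apply: leq_imset_card.
Qed.

Lemma ends1 U g : g \in U -> g.1 \in ends U.
Proof. by move=> gU; rewrite inE imset_f. Qed.

Lemma ends2 U g : g \in U -> g.2 \in ends U.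
Proof. by move=> gU; rewrite inE [X in _ || X]imset_f ?orbT. Qed.

Hypothesis plam2 : 2 * p <= lam.

Lemma p2_ge0 : 0 <= 2 * p. Proof. by rewrite mulr_ge0 // ltW. Qed.
Lemma p2_le1 : 2 * p <= 1. Proof. by apply: le_trans plam2 _; apply: le_trans lam12 _; lra. Qed.

Lemma clique_cost_ge0 i : 0 <= clique_cost i.
Proof.
rewrite /clique_cost; case: ifP => _; [exact: exprn_ge0 p2_ge0|exact: ltW lam0].
Qed.

Lemma clique_cost2_ge0 i : 0 <= clique_cost2 i.
Proof.
have := clique_cost_ge0 i; rewrite /clique_cost2; case: ifP => // _ c0.
by rewrite mulr_ge0 // p2_ge0.
Qed.

(** As g lies inside Y, each pair of A not inside Y is in Q and outside U. Such pairs exist unless A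
    is contained in Y, and then [lam] is the bound. *)
Lemma item_cost_le U (Y : {set V}) A g Q : ends U \subset Y -> #|A| = r ->
  g \in prs A -> g.1 \in Y -> g.2 \in Y -> prs A :\ g \subset Q ->
  item_cost U Q <= clique_cost #|A :&: Y|.
Proof.
move=> /subsetP UY cA gA g1 g2 sQ.
have gAY : g \in prs (A :&: Y).
  by move: gA; rewrite !in_prs !in_setI g1 g2 !andbT.
have sub : prs A :\: prs (A :&: Y) \subset Q :\: U.
  apply/subsetP => x; rewrite in_setD => /andP[xAY xA]; rewrite in_setD; apply/andP; split.
    apply: contra xAY => xU; move: xA; rewrite !in_prs !in_setI => /and3P[-> -> ->].
    by rewrite UY ?ends1 // UY ?ends2.
  apply: (subsetP sQ); rewrite in_setD1 xA andbT.
  by apply: contraNneq xAY => ->.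
have card : ('C(r, 2) - 'C(#|A :&: Y|, 2) <= #|Q :\: U|)%N.
  apply: leq_trans (subset_leq_card sub).
  have sI : prs (A :&: Y) \subset prs A by apply/prsS/subsetIl.
  by rewrite cardsD (setIidPr sI) !card_prs cA.
rewrite /item_cost /clique_cost; case: ifP => QU.
  case: ltnP => // iR.
  move: QU; rewrite -setD_eq0 => /eqP QU; move: card; rewrite QU cards0 leqn0 subn_eq0.
  rewrite leqNgt; case/negP.
  move: r3; rewrite -(ltn_predK iR) ltnS => k2; rewrite binS bin1.
  rewrite -[X in (X < _)%N]addn0 -addnS leq_add //.
    by apply: leq_bin2l; rewrite -ltnS (ltn_predK iR).
  exact: leq_trans k2.
case: ltnP => _; first by apply: ler_wiXn2l; rewrite ?p2_ge0 ?p2_le1.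
have : (0 < #|Q :\: U|)%N by rewrite card_gt0 setD_eq0 QU.
case: #|Q :\: U| => // k _; apply: le_trans plam2; rewrite exprS ler_piMr ?p2_ge0 //.
by rewrite exprn_ile1 ?p2_ge0 ?p2_le1.
Qed.

Definition clique_items g : pred ({set V} * P) :=
  fun j => [&& #|j.1| == r, g \in prs j.1 & j.2 \in prs j.1 :\ g].

(** The sum runs over decided and undecided m alike: the former dominate [haz s g], the latter the
    weights that g would close. *)
Definition clique_count g s : R :=
  \sum_(j | clique_items g j) item_val (prs j.1 :\ g) j.2 s.

Lemma clique_countE g s : clique_count g s =
  \sum_(A : {set V} | (#|A| == r) && (g \in prs A))
    \sum_(m in prs A :\ g) item_val (prs A :\ g) m s.
Proof.
by rewrite pair_big_dep /=; apply: eq_bigl => j; rewrite /clique_items andbA.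
Qed.

Lemma haz_le_count l s g : inv l s -> haz s g <= clique_count g s.
Proof.
move=> I; apply: le_trans (inv_hazb I g) _; rewrite clique_countE.
apply: ler_sum => A _; rewrite big_mkcondr /=; apply: ler_sum => m _.
by case: ifP => // _; exact: item_val_ge0 I.
Qed.

Lemma closes_le_count l s f : inv l s ->
  \sum_(g in closes s f) p * wt s g <= clique_count f s.
Proof.
move=> I; rewrite clique_countE (exchange_big_dep predT) //=.
rewrite [leLHS]big_mkcond; apply: ler_sum => g _; case: ifP => gC; last first.
  by apply: sumr_ge0 => A _; exact: item_val_ge0 I.
case/closesP: gC => gd gf [A [cA fA gA sub]].
rewrite (bigD1 A) /=; last by rewrite cA eqxx fA in_setD1 gf.
rewrite {1}/item_val sub mul1r lerDl; apply: sumr_ge0 => B _; exact: item_val_ge0 I.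
Qed.

Lemma clique_items_cost g U y : g \in prs setT -> (2 * #|U| + 2 <= y)%N ->
  \sum_(j | clique_items g j) item_cost U (prs j.1 :\ g) <= clique_sum clique_cost y.
Proof.
move=> gT Uy.
have g12 : g.1 != g.2 by move: gT; rewrite in_prs neq_ltn => /and3P[_ _ ->].
(* The touched vertices, at most 2 per pair of U plus the ends of g. *)
pose Y := ends U :|: [set g.1; g.2].
have Yy : (#|Y| <= y)%N.
  apply: leq_trans (leq_trans _ Uy); first exact: leqnn.
  apply: leq_trans (leq_card_setU _ _) _; rewrite leq_add ?card_ends //.
  by rewrite cards2 g12.
have gY1 : g.1 \in Y by rewrite !inE eqxx orbT.
have gY2 : g.2 \in Y by rewrite !inE eqxx !orbT.
have -> : \sum_(j | clique_items g j) item_cost U (prs j.1 :\ g) =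
   \sum_(A : {set V} | (#|A| == r) && (g \in prs A))
      \sum_(m in prs A :\ g) item_cost U (prs A :\ g).
  by rewrite pair_big_dep /=; apply: eq_bigl => j; rewrite /clique_items andbA.
rewrite /clique_sum.
apply: (@le_trans _ _ ('C(r, 2)%:R * \sum_(A : {set V} | (#|A| == r) && (g \in prs A))
    clique_cost #|A :&: Y|)); last first.
  rewrite ler_wpM2l //; apply: clique_sum_bound => // i; exact: clique_cost_ge0.
rewrite mulr_sumr; apply: ler_sum => A /andP[/eqP cA gA].
rewrite sumr_const mulr_natl -cA -card_prs.
apply: (@le_trans _ _ (clique_cost #|A :&: Y| *+ #|prs A :\ g|)).
  by apply: ler_wMn2r; apply: (@item_cost_le _ _ _ g) => //; rewrite subsetUl.
by apply: ler_wpMn2l; rewrite ?clique_cost_ge0 // subset_leq_card // subsetDl.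
Qed.

Definition pair_items g h : pred ({set V} * P) :=
  fun j => [&& #|j.1| == r, g \in prs j.1, h.1 \notin j.1, j.2 \in prs j.1 :\ g,
               j.2.1 != g.1, j.2.1 != g.2 & (j.2.1 < h.1)%N].

Definition pair_item_set g h (j : {set V} * P) : {set P} := (j.2.1, h.1) |: (prs j.1 :\ g).

Definition pair_count_val g h s : R :=
  \sum_(j | pair_items g h j) item_val (pair_item_set g h j) j.2 s.

Lemma pair_sumE g h (F : {set V} -> P -> R) :
  \sum_(j | pair_items g h j) F j.1 j.2 =
  \sum_(A : {set V} | [&& #|A| == r, g \in prs A & h.1 \notin A])
    \sum_(m in prs A :\ g | [&& m.1 != g.1, m.1 != g.2 & (m.1 < h.1)%N]) F A m.
Proof.
by rewrite pair_big_dep /=; apply: eq_bigl => j; rewrite /pair_items -!andbA.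
Qed.

Lemma haz2_le_count l s g h : inv l s -> haz2 s g h <= pair_count_val g h s.
Proof.
move=> I; apply: le_trans (inv_haz2b I g h) _.
rewrite /pair_count_val /pair_item_set.
rewrite (pair_sumE g h (fun A m => item_val ((m.1, h.1) |: (prs A :\ g)) m s)).
apply: ler_sum => A _; rewrite 2!big_mkcondr /=; apply: ler_sum => m _.
case md: (m \in dec s) => /=; last first.
  by case: ifP => // _; exact: item_val_ge0 I.
case: ifP => // _; rewrite /item_val ler_wpM2r ?(prob_ge0 m I) // ler_nat.
case E: (_ && _) => //; case/andP: E => sub e.
rewrite (_ : _ \subset gr s) //; apply/subsetP => x; rewrite in_setD1 in_setU1.
case/andP=> xm /orP[/eqP->//|xA]; apply: (subsetP sub).
by rewrite in_setD1 xm.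
Qed.

(** With overlap 2, A meets Y only in the ends of g, so x.1 is untouched and x is a new pair: this
    gains one more factor 2 p. For larger overlaps x may already be in U and nothing is gained. *)
Lemma pair_item_cost U (Y : {set V}) A g x : ends U \subset Y -> #|A| = r ->
  g \in prs A -> g.1 \in Y -> g.2 \in Y -> x.1 \in A -> x.1 != g.1 -> x.1 != g.2 ->
  x.2 \notin A ->
  item_cost U (x |: (prs A :\ g)) <= clique_cost2 #|A :&: Y|.
Proof.
move=> UY cA gA g1 g2 xA x1 x2 x2A.
have base : item_cost U (x |: (prs A :\ g)) <= clique_cost #|A :&: Y|.
  by apply: (@item_cost_le _ _ _ g) => //; apply: subsetUr.
rewrite /clique_cost2; case: eqP => // c2.
have gAY : g \in prs (A :&: Y).
  by move: gA; rewrite !in_prs !in_setI g1 g2 !andbT.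
have xY : x.1 \notin Y.
  apply/negP => xY; have : (2 < #|A :&: Y|)%N; last by rewrite c2.
  have g12 : g.1 != g.2 by move: gA; rewrite in_prs neq_ltn => /and3P[_ _ ->].
  have sub : x.1 |: [set g.1; g.2] \subset A :&: Y.
    move: gAY; rewrite in_prs => /and3P[a b _].
    apply/subsetP => z; rewrite in_setU1 in_set2.
    by case/or3P=> /eqP -> //; rewrite in_setI xA.
  apply: leq_trans (subset_leq_card sub).
  by rewrite cardsU1 cards2 g12 in_set2 negb_or x1 x2.
have xU : x \notin U.
  by apply: contra xY => xU; apply: (subsetP UY); apply: ends1.
rewrite /item_cost ifF; last first.
  by apply/negP => /subsetP /(_ x); rewrite setU11 (negbTE xU) => /(_ isT).
have sub : x |: (prs A :\: prs (A :&: Y)) \subset (x |: (prs A :\ g)) :\: U.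
  apply/subsetP => z; rewrite in_setU1 => /orP[/eqP->|]; first by rewrite in_setD xU setU11.
  case/setDP=> zA zAY; rewrite in_setD; apply/andP; split.
    apply: contra zAY => zU; move: zA; rewrite !in_prs !in_setI => /and3P[-> -> ->].
    by rewrite !(subsetP UY) ?ends1 ?ends2.
  rewrite in_setU1 in_setD1 zA andbT orbC.
  by rewrite (contraNneq _ zAY) // => ->.
have xD : x \notin prs A :\: prs (A :&: Y).
  by apply/negP => /setDP[]; rewrite in_prs (negbTE x2A) andbF.
have sI : prs (A :&: Y) \subset prs A by apply/prsS/subsetIl.
have card : (1 + ('C(r, 2) - 'C(2, 2)) <= #|(x |: (prs A :\ g)) :\: U|)%N.
  apply: leq_trans (subset_leq_card sub).
  by rewrite cardsU1 xD cardsD (setIidPr sI) !card_prs cA c2.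
rewrite /clique_cost c2 r3 -exprS.
by apply: ler_wiXn2l; rewrite ?p2_ge0 ?p2_le1.
Qed.

Lemma pair_items_cost g h U y : g \in prs setT -> (2 * #|U| + 2 <= y)%N ->
  \sum_(j | pair_items g h j) item_cost U (pair_item_set g h j) <= clique_sum clique_cost2 y.
Proof.
move=> gT Uy.
have g12 : g.1 != g.2 by move: gT; rewrite in_prs neq_ltn => /and3P[_ _ ->].
pose Y := ends U :|: [set g.1; g.2].
have Yy : (#|Y| <= y)%N.
  apply: leq_trans (leq_trans _ Uy); first exact: leqnn.
  apply: leq_trans (leq_card_setU _ _) _; rewrite leq_add ?card_ends //.
  by rewrite cards2 g12.
have gY1 : g.1 \in Y by rewrite !inE eqxx orbT.
have gY2 : g.2 \in Y by rewrite !inE eqxx !orbT.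
rewrite /pair_item_set (pair_sumE g h (fun A m => item_cost U ((m.1, h.1) |: (prs A :\ g)))).
rewrite /clique_sum.
apply: (@le_trans _ _ ('C(r, 2)%:R * \sum_(A : {set V} | (#|A| == r) && (g \in prs A))
    clique_cost2 #|A :&: Y|)); last first.
  rewrite ler_wpM2l //; apply: clique_sum_bound => // i; exact: clique_cost2_ge0.
rewrite mulr_sumr big_mkcond [leRHS]big_mkcond; apply: ler_sum => A _.
case: ifP => [/and3P[/eqP cA gA hA]|_]; last first.
  by case: ifP => // _; rewrite mulr_ge0 ?clique_cost2_ge0.
rewrite cA eqxx gA /= mulr_natl -cA -card_prs.
rewrite -sumr_const big_mkcondr /= [leRHS](big_setID (prs A :\ g)) /=.
have -> : prs A :&: (prs A :\ g) = prs A :\ g by apply/setIidPr/subsetDl.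
rewrite -[leLHS]addr0 lerD //; last by apply: sumr_ge0 => m _; exact: clique_cost2_ge0.
apply: ler_sum => m mA; case: ifP => [/and3P[m1 m2 mh]|_]; last exact: clique_cost2_ge0.
apply: pair_item_cost => //=; first exact: subsetUl.
by move: mA; rewrite in_setD1 in_prs => /and4P[].
Qed.

Lemma card_clique_item g j : clique_items g j -> (#|prs j.1 :\ g| <= 'C(r, 2))%N.
Proof.
by case/and3P=> /eqP cA gA _; rewrite -cA -card_prs subset_leq_card // subsetDl.
Qed.

Lemma card_pair_item g h j : pair_items g h j -> (#|pair_item_set g h j| <= 'C(r, 2))%N.
Proof.
case/and3P=> /eqP cA gA _; rewrite -cA -card_prs (cardsD1 g (prs _)) gA cardsU1.
by apply: leq_add => //; apply: leq_b1.
Qed.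

Lemma clique_sum_ge0 (c : nat -> R) y : (forall i, 0 <= c i) -> 0 <= clique_sum c y.
Proof.
by move=> c0; rewrite mulr_ge0 // sumr_ge0 // => i _; rewrite mulr_ge0.
Qed.

Lemma clique_moment g b N y : (b * 'C(r, 2) <= N)%N -> (2 * N + 2 <= y)%N ->
  Ex schedule start (fun s => clique_count g s ^+ b) <=
  clique_sum clique_cost y ^+ b * expR ((N ^ 2)%:R * (eta + lam)).
Proof.
move=> bN Ny.
have H : forall U, (#|U| <= N)%N ->
    \sum_(j | clique_items g j) item_cost U (prs j.1 :\ g) <= clique_sum clique_cost y.
  move=> U UN; case: (boolP (g \in prs setT)) => gT; last first.
    rewrite big_pred0 ?clique_sum_ge0 //; first exact: clique_cost_ge0.
    move=> j; apply/negP => /and3P[_ gA _]; case/negP: gT.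
    by apply: (subsetP (prsS (subsetT j.1))).
  by apply: clique_items_cost => //; apply: leq_trans Ny; rewrite leq_add2r leq_mul2l UN orbT.
have := @moment_bound _ (clique_items g) _ snd 'C(r, 2) N _ _ (@card_clique_item g) H b set0.
rewrite cards0 add0n expr0 mul1r => /(_ _ bN) K.
rewrite (@eq_Ex _ (fun s => (\prod_(u in set0) yv s u) *
  (\sum_(j | clique_items g j) item_val (prs j.1 :\ g) j.2 s) ^+ b)).
  by apply: K => j /and3P[].
by move=> s; rewrite big_set0 mul1r.
Qed.

Lemma pair_moment g h b N y : (b * 'C(r, 2) <= N)%N -> (2 * N + 2 <= y)%N ->
  Ex schedule start (fun s => pair_count_val g h s ^+ b) <=
  clique_sum clique_cost2 y ^+ b * expR ((N ^ 2)%:R * (eta + lam)).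
Proof.
move=> bN Ny.
have H : forall U, (#|U| <= N)%N ->
    \sum_(j | pair_items g h j) item_cost U (pair_item_set g h j) <= clique_sum clique_cost2 y.
  move=> U UN; case: (boolP (g \in prs setT)) => gT; last first.
    rewrite big_pred0 ?clique_sum_ge0 //; first exact: clique_cost2_ge0.
    move=> j; apply/negP => /and3P[_ gA _]; case/negP: gT.
    by apply: (subsetP (prsS (subsetT j.1))).
  by apply: pair_items_cost => //; apply: leq_trans Ny; rewrite leq_add2r leq_mul2l UN orbT.
have := @moment_bound _ (pair_items g h) _ snd 'C(r, 2) N _ _ (@card_pair_item g h) H b set0.
rewrite cards0 add0n expr0 mul1r => /(_ _ bN) K.
rewrite (@eq_Ex _ (fun s => (\prod_(u in set0) yv s u) *
  (\sum_(j | pair_items g h j) item_val (pair_item_set g h j) j.2 s) ^+ b)).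
  by apply: K => j /and5P[_ _ _ mA _]; rewrite setU1r.
by move=> s; rewrite big_set0 mul1r.
Qed.

(** * The union bound *)

(** Only pairs h with h.2 = g.2 contribute to [pair_haz], which gives C(k,2) * k terms instead of
    C(k,2)^2. *)
Lemma hit_upper (I : {set V}) l s k : inv l s -> #|I| = k ->
  hit_rate * (\sum_(g in prs I) haz s g + pair_haz (prs I) s) <=
  hit_rate * ('C(k, 2)%:R * (sigma + lam) + ('C(k, 2) * k)%:R * (eta + lam)).
Proof.
move=> Iv cI.
have sl0 : 0 <= sigma + lam by rewrite addr_ge0 // ltW // lam0.
have el0 : 0 <= eta + lam by rewrite addr_ge0 // ltW // lam0.
have hr0 : 0 <= hit_rate.
  by apply: mulr_ge0 (expR_ge0 _); apply: mulr_ge0 (sqr_ge0 _).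
rewrite ler_wpM2l // lerD //.
  rewrite -cI -card_prs mulr_natl -sumr_const; apply: ler_sum => g _; exact: inv_hazle Iv g.
rewrite -cI -card_prs natrM -mulrA mulr_natl -sumr_const; apply: ler_sum => g gI.
apply: (@le_trans _ _ (\sum_(h in [set h in prs I | h.2 == g.2]) (eta + lam))).
  rewrite [leRHS](eq_bigl (fun h => (h \in prs I) && (h.2 == g.2))); last first.
    by move=> h; rewrite inE.
  rewrite [leRHS]big_mkcondr; apply: ler_sum => h _; case: ifP => [_|/negbT hg].
    exact: inv_haz2le Iv g h.
  by rewrite (inv_row Iv) // eq_sym.
rewrite sumr_const mulr_natl; apply: ler_wpMn2l => //.
rewrite -(card_in_imset (f := fst)).
  by apply: subset_leq_card; apply/subsetP => x /imsetP[h]; rewrite inE in_prs => /andP[/and3P[]] + _ _ _ -> .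
move=> [a b] [c d]; rewrite !inE /= => /andP[_ /eqP->] /andP[_ /eqP->] -> //.
Qed.

(** If no graph works, each terminal state is bad: a count exceeds its threshold ([T1], [T2], by
    Markov's inequality for b-th moments) or a k-set spans no edge ([T3]). The expectation 1 of the
    constant 1 would then be at most 3/4. *)
Theorem exists_clique_free_hitting_graph (k b N y : nat) :
  (b * 'C(r, 2) <= N)%N -> (2 * N + 2 <= y)%N ->
  (n ^ 2)%:R * (clique_sum clique_cost y / sigma) ^+ b *
     expR ((N ^ 2)%:R * (eta + lam)) <= 1 / 4%:R ->
  (n ^ 4)%:R * (clique_sum clique_cost2 y / eta) ^+ b *
     expR ((N ^ 2)%:R * (eta + lam)) <= 1 / 4%:R ->
  'C(n, k)%:R * expR (- (p * 'C(k, 2)%:R) +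
     hit_rate * ('C(k, 2)%:R * (sigma + lam) + ('C(k, 2) * k)%:R * (eta + lam))) <= 1 / 4%:R ->
  exists G : {set P}, [/\ G \subset prs setT,
     forall A, #|A| = r -> ~~ (prs A \subset G) &
     forall I : {set V}, #|I| = k -> ~~ [disjoint prs I & G]].
Proof.
move=> bN Ny H1 H2 H3.
set K := hit_rate * _ in H3; set D := expR (_ * (eta + lam)) in H1 H2.
set M1 := clique_sum clique_cost y in H1; set M2 := clique_sum clique_cost2 y in H2.
case: (boolP [exists G : {set P}, [&& G \subset prs setT,
     [forall A : {set V}, (#|A| == r) ==> ~~ (prs A \subset G)] &
     [forall I : {set V}, (#|I| == k) ==> ~~ [disjoint prs I & G]]]]).
  case/existsP => G /and3P[GT /forallP G1 /forallP G2]; exists G; split=> // [A cA|I cI].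
    by have := G1 A; rewrite cA eqxx.
  by have := G2 I; rewrite cI eqxx.
move=> /existsPn none; exfalso.
pose T1 s := \sum_(g : P) sigma ^- b * clique_count g s ^+ b.
pose T2 s := \sum_(gh : P * P) eta ^- b * pair_count_val gh.1 gh.2 s ^+ b.
pose T3 s := \sum_(I : {set V} | #|I| == k) expR K * hit_pot (prs I) s.
have cc0 l s g : inv l s -> 0 <= clique_count g s.
  by move=> Iv; apply: sumr_ge0 => j _; exact: item_val_ge0 Iv.
have pc0 l s g h : inv l s -> 0 <= pair_count_val g h s.
  by move=> Iv; apply: sumr_ge0 => j _; exact: item_val_ge0 Iv.
have key : Ex schedule start (fun=> 1) <= Ex schedule start (fun s => T1 s + (T2 s + T3 s)).
  apply: (Ex_mono inv_start) => l s Iv.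
  have T10 : 0 <= T1 s.
    by apply: sumr_ge0 => g _; rewrite mulr_ge0 ?invr_ge0 ?exprn_ge0 ?(ltW sigma0) ?(cc0 _ _ _ Iv).
  have T20 : 0 <= T2 s.
    by apply: sumr_ge0 => g _; rewrite mulr_ge0 ?invr_ge0 ?exprn_ge0 ?(ltW eta0) ?(pc0 _ _ _ _ Iv).
  have T30 : 0 <= T3 s.
    by apply: sumr_ge0 => I _; rewrite mulr_ge0 ?expR_ge0 // mulr_ge0 ?expR_ge0.
  have big1le g : sigma < clique_count g s -> 1 <= T1 s.
    move=> sg; rewrite /T1 (bigD1 g) //=.
    apply: (@le_trans _ _ (sigma ^- b * clique_count g s ^+ b)); last first.
      rewrite lerDl; apply: sumr_ge0 => h _.
      by rewrite mulr_ge0 ?invr_ge0 ?exprn_ge0 ?(ltW sigma0) ?(cc0 _ _ _ Iv).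
    rewrite mulrC ler_pdivlMr ?exprn_gt0 // mul1r lerXn2r ?nnegrE ?(ltW sigma0) ?(ltW sg) //.
    exact: cc0 Iv.
  have big2le g h : eta < pair_count_val g h s -> 1 <= T2 s.
    move=> sg; rewrite /T2 (bigD1 (g, h)) //=.
    apply: (@le_trans _ _ (eta ^- b * pair_count_val g h s ^+ b)); last first.
      rewrite lerDl; apply: sumr_ge0 => ? _.
      by rewrite mulr_ge0 ?invr_ge0 ?exprn_ge0 ?(ltW eta0) ?(pc0 _ _ _ _ Iv).
    rewrite mulrC ler_pdivlMr ?exprn_gt0 // mul1r lerXn2r ?nnegrE ?(ltW eta0) ?(ltW sg) //.
    exact: pc0 Iv.
  case: l Iv cc0 pc0 => [|f l] Iv cc0 pc0 /= tm; last first.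
    move: tm; rewrite /active !negb_and => /or3P[].
    - case/forallPn => g; rewrite -ltNge => sg.
      have := big1le g (lt_le_trans sg (haz_le_count g Iv)); lra.
    - case/forallPn => g /forallPn[h]; rewrite -ltNge => sg.
      have := big2le g h (lt_le_trans sg (haz2_le_count g h Iv)); lra.
    - rewrite -ltNge => sg.
      have := big1le f (lt_le_trans sg (closes_le_count f Iv)); lra.
  have decT : prs setT = dec s.
    by apply/setP => g; rewrite (inv_cover Iv) in_nil orbF.
  have := none (gr s); rewrite decT (inv_gr Iv) /=.
  have -> : [forall A : {set V}, (#|A| == r) ==> ~~ (prs A \subset gr s)].
    by apply/forallP => A; apply/implyP => /eqP cA; exact: inv_free Iv A cA.
  case/forallPn => I; rewrite negb_imply negbK => /andP[cI dI].
  suff : 1 <= T3 s by lra.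
  rewrite /T3 (bigD1 I) //=.
  apply: (@le_trans _ _ (expR K * hit_pot (prs I) s)); last first.
    by rewrite lerDl; apply: sumr_ge0 => J _; rewrite mulr_ge0 ?expR_ge0 // mulr_ge0 ?expR_ge0.
  rewrite /hit_pot dI mul1r -expRD.
  (* All pairs are decided, so the exponent keeps only the hazard correction, which K dominates. *)
  have -> : prs I :\: dec s = set0.
    by apply/eqP; rewrite setD_eq0 -decT; apply: prsS (subsetT _).
  rewrite big_set0 mulr0 oppr0 add0r -[leLHS](@expR0 R) ler_expR subr_ge0.
  exact: hit_upper Iv (eqP cI).
rewrite Ex_cst !ExD !Ex_sum in key.
have e1 : \sum_(g : P) Ex schedule start (fun s => sigma ^- b * clique_count g s ^+ b) <= 1 / 4%:R.
  apply: le_trans H1.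
  apply: (@le_trans _ _ (\sum_(g : P) sigma ^- b * (M1 ^+ b * D))).
    apply: ler_sum => g _; rewrite ExZ ler_wpM2l ?invr_ge0 ?exprn_ge0 ?(ltW sigma0) //.
    exact: clique_moment.
  rewrite sumr_const card_prod card_ord mulnn -[leLHS]mulr_natl expr_div_n.
  by apply: eq_refl_le; ring.
have e2 : \sum_(gh : P * P) Ex schedule start
    (fun s => eta ^- b * pair_count_val gh.1 gh.2 s ^+ b) <= 1 / 4%:R.
  apply: le_trans H2.
  apply: (@le_trans _ _ (\sum_(gh : P * P) eta ^- b * (M2 ^+ b * D))).
    apply: ler_sum => g _; rewrite ExZ ler_wpM2l ?invr_ge0 ?exprn_ge0 ?(ltW eta0) //.
    exact: pair_moment.
  rewrite sumr_const !card_prod card_ord !mulnn -expnM -[leLHS]mulr_natl expr_div_n.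
  by apply: eq_refl_le; ring.
have e3 : \sum_(I : {set V} | #|I| == k) Ex schedule start
    (fun s => expR K * hit_pot (prs I) s) <= 1 / 4%:R.
  apply: le_trans H3.
  apply: (@le_trans _ _ (\sum_(I : {set V} | #|I| == k) expR K * expR (- (p * 'C(k, 2)%:R)))).
    apply: ler_sum => I /eqP cI; rewrite ExZ ler_wpM2l ?expR_ge0 // -cI -card_prs.
    by apply: hit_bound; apply: prsS (subsetT _).
  rewrite -expRD sumr_const [leRHS]mulr_natl addrC.
  rewrite (_ : #|_| = 'C(n, k)) // -[n in RHS]card_ord -cardsT -cards_draws.
  by apply: eq_card => I; rewrite !inE subsetT.
move: (lerD e1 (lerD e2 e3)) => e4; have := le_trans key e4; lra.
Qed.
End Process.

(** * Choice of the parameters *)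

Section RamseyGraph.
Variable R : realType.

Lemma poly_le_expR (C : R) (m : nat) : exists T : R, 1 <= T /\
  forall t, T <= t -> C * t ^+ m <= expR t.
Proof.
pose f : R := (m.+1)`!%:R.
exists (1 + `|C| * f); split; first by rewrite lerDl mulr_ge0 ?ler0n.
move=> t Tt.
have f0 : 0 < f by rewrite ltr0n fact_gt0.
have t0 : 0 <= t by apply: le_trans Tt; rewrite addr_ge0 // mulr_ge0 // ltW.
apply: (@le_trans _ _ (t ^+ m.+1 / f)); last first.
  by apply: le_trans (expR_ge1Dxn m t0); rewrite lerDr.
rewrite ler_pdivlMr // mulrAC exprS ler_wpM2r ?exprn_ge0 //.
apply: le_trans Tt; apply: (@le_trans _ _ (`|C| * f)); last by rewrite lerDr.
by rewrite ler_wpM2r ?ler_norm // ltW.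
Qed.

Lemma doubled_bin2 m : (2 * 'C(m, 2) = m * m.-1)%N.
Proof. by rewrite -mul_bin_diag bin1. Qed.

(** The balance fixing the density: n^(r-2) with n = e^(16 (r+1) t) cancels against the power C(r,2)
    - 1 of e^(-32 t). *)
Lemma clique_exponent2 r : (3 <= r)%N ->
  ((r + 1) * (r - 2) = 2 * ('C(r, 2) - 'C(2, 2)))%N.
Proof.
by move=> r3; rewrite [RHS]mulnBr !doubled_bin2; nia.
Qed.

(** For overlaps i >= 3 the surplus 1 gives a factor e^(-16 t), which beats every polynomial in
    t. *)
Lemma clique_exponent i r : (3 <= i)%N -> (i < r)%N ->
  ((r + 1) * (r - i) + 1 <= 2 * ('C(r, 2) - 'C(i, 2)))%N.
Proof.
move=> i3 ir; rewrite [leqRHS]mulnBr !doubled_bin2.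
have [d ->] : exists d, r = (i + d.+1)%N by exists (r - i).-1; lia.
by case: i i3 {ir} => [|[|[|i]]] // _; nia.
Qed.

Lemma clique_sum_split (n r y : nat) (c : nat -> R) (A Y : R) : (3 <= r)%N ->
  (n ^ (r - 2))%:R * c 2%N <= A ->
  (forall i, (3 <= i <= r)%N -> (y ^ (i - 2) * n ^ (r - i))%:R * c i <= Y) -> 0 <= Y ->
  clique_sum n r c y <= 'C(r, 2)%:R * (A + r%:R * Y).
Proof.
move=> r3 c2 ci Y0; rewrite /clique_sum ler_wpM2l ?ler0n // big_ltn; last by rewrite ltnS ltnW.
rewrite expn0 mul1n lerD //.
apply: (@le_trans _ _ (\sum_(3 <= i < r.+1) Y)).
  by apply: ler_sum_nat => i; rewrite ltnS; apply: ci.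
by rewrite sumr_const_nat mulr_natl; apply: ler_wpMn2l => //; lia.
Qed.

Section Estimates.
Variables (n r y : nat) (t l p lam kap : R).
Hypothesis r3 : (3 <= r)%N.
Hypothesis t1 : 1 <= t.
Hypothesis n_def : n%:R = expR ((16 * (r + 1))%:R * t).
Hypothesis l0 : 0 < l.
Hypothesis lt : l <= t.
Hypothesis l_def : l ^+ ('C(r, 2) - 1) = t / kap.
Hypothesis p_def : 2 * p = l * expR (- (32%:R * t)).
Hypothesis lam_le : lam <= expR (- (16%:R * t)).
Hypothesis lam0 : 0 <= lam.
Hypothesis y1 : (1 <= y)%N.

Definition tail_bound : R := y%:R ^+ r * t ^+ 'C(r, 2) * expR (- (16%:R * t)).

Lemma first_clique_term : (n ^ (r - 2))%:R * clique_cost r p lam 2 = t / kap.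
Proof.
rewrite /clique_cost r3 p_def exprMn binn l_def natrX n_def -!expRM_natl mulrCA -expRD.
rewrite (_ : _ + _ = 0) ?expR0 ?mulr1 //.
have e : (r + 1)%:R * (r - 2)%:R = 2 * ('C(r, 2) - 1)%:R :> R.
  by rewrite -!natrM clique_exponent2 // binn.
rewrite natrM (_ : _ + _ = 16%:R * t * ((r + 1)%:R * (r - 2)%:R - 2 * ('C(r, 2) - 1)%:R)); last by ring.
by rewrite e; ring.
Qed.

Lemma later_clique_term i : (3 <= i <= r)%N ->
  (y ^ (i - 2) * n ^ (r - i))%:R * clique_cost r p lam i <= tail_bound.
Proof.
have t0 : 0 <= t by apply: le_trans t1.
have yy j : (j <= r)%N -> (y ^ j)%:R <= y%:R ^+ r :> R.
  by move=> jr; rewrite natrX ler_weXn2l ?ler1n.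
case/andP=> i3; rewrite leq_eqVlt => /orP[/eqP->|ir].
  rewrite /clique_cost ltnn subnn expn0 muln1 /tail_bound.
  apply: ler_pM => //.
  rewrite -[leLHS]mulr1; apply: ler_pM; rewrite ?ler0n ?exprn_ege1 ?yy //.
  exact: leq_subr.
rewrite /clique_cost ir p_def natrM -mulrA /tail_bound -mulrA.
apply: ler_pM; rewrite ?ler0n ?yy //.
- by rewrite mulr_ge0 // exprn_ge0 // mulr_ge0 ?expR_ge0 // ltW.
- by rewrite (leq_trans (leq_subr _ _)) // ltnW.
set m := ('C(r, 2) - 'C(i, 2))%N.
have e : (r + 1)%:R * (r - i)%:R + 1 <= 2 * m%:R :> R.
  by rewrite -!natrM natr1 ler_nat -addn1 clique_exponent.
rewrite exprMn mulrCA; apply: ler_pM; rewrite ?exprn_ge0 ?(ltW l0) //.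
- by rewrite mulr_ge0 // exprn_ge0 // expR_ge0.
- apply: (@le_trans _ _ (t ^+ m)); first by rewrite lerXn2r ?nnegrE ?(ltW l0).
  by rewrite ler_weXn2l // leq_subr.
rewrite natrX n_def -!expRM_natl -expRD ler_expR natrM.
have := ler_wpM2l t0 e; lra.
Qed.
End Estimates.

Lemma nat_ceil (x : R) : 0 <= x -> exists m : nat, x <= m%:R <= x + 1.
Proof.
move=> x0; exists (Num.truncn x).+1; have /andP[a b] := truncn_itv x0.
by rewrite (ltW b) -natr1 lerD.
Qed.

(* Parameters: sigma = t, 2 p = l e^(-32 t), lam = p e^(3 t), eta = e^(-12 t),
   k ~ 64 (r + 1) t / p. The choice of l makes the main (i = 2) term of the
   expected hazard a small multiple of t; the moment of order b ~ t then beats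
   the union bound over at most n^4 quadruples. *)
Theorem exists_ramsey_graph (r : nat) : (3 <= r)%N -> exists T c : R, [/\ 1 <= T, 0 < c &
  forall (n : nat) (t : R), T <= t -> n%:R = expR ((16 * (r + 1))%:R * t) ->
  exists (k : nat) (G : {set 'I_n * 'I_n}), [/\ G \subset prs setT,
    forall A : {set 'I_n}, #|A| = r -> ~~ (prs A \subset G),
    forall I : {set 'I_n}, #|I| = k -> ~~ [disjoint prs I & G] &
    k%:R <= c * t * expR (32%:R * t) * expR (- (ln t / ('C(r, 2) - 1)%:R))]].
Proof.
move=> r3.
pose e : nat := 'C(r, 2).
have e3 : (3 <= e)%N := @leq_bin2l 3 r 2 r3.
have e1 : 1 <= e%:R :> R by rewrite ler1n (leq_trans _ e3).
(* As b >= t, a ratio at most e^(-M) has b-th power at most e^(-M t): 64 (r + 1) cancels n^4, and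
   the surplus 8 leaves e^(-8 t). *)
pose M : R := (64 * (r + 1) + 8)%:R.
(* Makes the main term of the clique sum exactly half of e^(-M) t; the tail fits into the other
   half. *)
pose kap : R := 2 * e%:R * expR M.
have M0 : 0 <= M by apply: ler0n.
have kap1 : 1 <= kap.
  have : 1 <= expR M by rewrite -[leLHS](@expR0 R) ler_expR.
  rewrite /kap; nra.
have kap0 : 0 < kap by apply: lt_le_trans kap1.
pose f := ('C(r, 2) - 1)%:R : R.
have f1 : 1 <= f by rewrite /f ler1n subn_gt0 (leq_trans _ e3).
have f0 : 0 < f by apply: lt_le_trans f1.
have [T1 [T11 P1]] := poly_le_expR (e%:R * r%:R * (6%:R * e%:R) ^+ r) (r + e).
have [T2 [T21 P2]] := poly_le_expR kap 0.
have [T3 [T31 P3]] := poly_le_expR (2 * expR M) 0.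
have [T4 [T41 P4]] := poly_le_expR (16%:R * e%:R ^+ 2) 2.
have [T5 [T51 P5]] := poly_le_expR (2080%:R * (r + 1)%:R) 1.
exists (T1 + T2 + T3 + T4 + T5), (130%:R * (r + 1)%:R * expR (ln kap / f)); split.
- lra.
- by rewrite !mulr_gt0 ?expR_gt0 ?ltr0n // addn1.
move=> n t Tt n_def.
have {}P1 := P1 t ltac:(lra). have {}P2 := P2 t ltac:(lra).
have {}P3 := P3 t ltac:(lra). have {}P4 := P4 t ltac:(lra).
have {}P5 := P5 t ltac:(lra).
rewrite expr0 mulr1 in P2; rewrite expr0 mulr1 in P3; rewrite expr1 in P5.
have t1 : 1 <= t by clear -Tt T11 T21 T31 T41 T51; lra.
have t0 : 0 < t by clear -t1; lra.
clear T1 T2 T3 T4 T5 T11 T21 T31 T41 T51 Tt.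
have tkap0 : 0 < t / kap by rewrite divr_gt0.
pose l : R := expR (ln (t / kap) / f).
have l0 : 0 < l := expR_gt0 _.
have l_def : l ^+ ('C(r, 2) - 1) = t / kap.
  by rewrite -expRM_natl -/f mulrC divfK ?gt_eqF // lnK.
have lt : l <= t.
  have fn : (0 < 'C(r, 2) - 1)%N by rewrite subn_gt0 (leq_trans _ e3).
  rewrite -(ler_pXn2r fn) ?nnegrE ?(ltW l0) ?(ltW t0) // l_def.
  apply: (@le_trans _ _ t); first by rewrite ler_pdivrMr // ler_peMr // ltW.
  by case: ('C(r, 2) - 1)%N fn => // m _; rewrite exprS ler_peMr ?exprn_ege1 // ltW.
pose E (m : nat) : R := expR (- (m%:R * t)).
have E0 m : 0 < E m := expR_gt0 _.
have EE m1 m2 : E m1 * E m2 = E (m1 + m2)%N.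
  by rewrite /E -expRD natrD; congr expR; ring.
have Emono m1 m2 : (m1 <= m2)%N -> E m2 <= E m1.
  by move=> mm; rewrite ler_expR lerN2 ler_wpM2r ?(ltW t0) // ler_nat.
have Edef : expR t * E 1 = 1 by rewrite /E mul1r -expRD subrr expR0.
have poly_E (x : R) m : x <= expR t -> x * E m.+1 <= E m.
  move=> xt; rewrite -[leRHS]mul1r -Edef -mulrA EE add1n ler_wpM2r ?(ltW (E0 _)) //.
pose p : R := l / 2 * E 32.
have p0 : 0 < p by rewrite !mulr_gt0 // invr_gt0.
have p_def : 2 * p = l * expR (- (32%:R * t)) by rewrite /p /E; field.
pose lam : R := p * expR (3%:R * t).
have exp3 : expR (3%:R * t) * E 3 = 1 by rewrite /E -expRD subrr expR0.
have tE : t <= expR t by apply: le_trans (expR_ge1Dx t); rewrite lerDr ler01.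
have lamE : lam <= E 28.
  have -> : lam = l / 2 * E 29.
    have e32 : E 32 = E 29 * E 3 by rewrite EE.
    rewrite /lam /p e32 -[RHS]mulr1 -[X in _ = _ * X]exp3; ring.
  apply: le_trans (poly_E t 28 tE); rewrite ler_wpM2r ?(ltW (E0 _)) //; clear -lt l0; lra.
have lam_gt0 : 0 < lam by rewrite mulr_gt0 ?expR_gt0.
have E1 m : E m.+1 <= 1 / 2.
  apply: le_trans (Emono 1%N m.+1 isT) _.
  have := expR_ge1Dx t; have := E0 1%N; clear -Edef t1; move: (E 1%N) Edef => x; nra.
have lam12 : lam <= 1 / 2 by apply: le_trans lamE (E1 27).
have plam : p * expR (2 * (t + lam)) <= lam.
  have h : 2 * (t + lam) <= 3%:R * t by clear -lam12 t1; move: lam lam12 => x; lra.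
  change (p * expR (2 * (t + lam)) <= p * expR (3%:R * t)).
  by rewrite ler_wpM2l ?(ltW p0) // ler_expR.
have plam2 : 2 * p <= lam.
  rewrite mulrC /lam ler_wpM2l ?(ltW p0) //; apply: le_trans (expR_ge1Dx _); clear -t1; lra.
(* Has to lie well above the tail e^(-15 t) and well below e^(-7 t), the inverse of the exponential
   in the hit rate. *)
pose eta := E 12.
have eta0 : 0 < eta := E0 _.
have [b /andP[b1 b2]] := nat_ceil (ltW t0).
pose N := (b * 'C(r, 2))%N; pose y := (2 * N + 2)%N.
pose a : R := (r + 1)%:R * t.
have a1 : 1 <= a by rewrite -[leLHS]mulr1 ler_pM // ler1n addn1.
have kk0 : 0 <= 64%:R * a / p + 1 by rewrite addr_ge0 // divr_ge0 ?(ltW p0) // mulr_ge0 // (le_trans _ a1).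
(* The number of k-sets is at most n^k = e^(16 a k). Here p C(k,2) >= 32 a k, the error terms take
   at most a quarter of it, and e^(-8 a k) remains. *)
have [k /andP[k1 k2]] := nat_ceil kk0.
have y1 : (1 <= y)%N by rewrite /y addn2.
have bR : b%:R <= 2 * t by clear -b2 t1; lra.
have NR : N%:R <= 2 * t * e%:R by rewrite /N natrM ler_wpM2r.
have yR : y%:R <= 6%:R * e%:R * t.
  have h : 1 <= e%:R * t by rewrite -[leLHS]mulr1 ler_pM.
  rewrite /y natrD natrM; clear -NR h; lra.
have tailE : e%:R * r%:R * tail_bound r y t <= E 15.
  rewrite /tail_bound -/(E 16) -/e mulrA.
  apply: le_trans (poly_E _ 15 P1); rewrite ler_wpM2r ?(ltW (E0 _)) // -!mulrA.
  rewrite !ler_wpM2l ?ler0n // exprD mulrA ler_wpM2r ?exprn_ge0 ?(ltW t0) // -exprMn.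
  have h : 0 <= 6%:R * e%:R * t by rewrite !mulr_ge0 ?ler0n // ltW.
  by apply: lerXn2r; rewrite ?nnegrE ?ler0n.
have tail0 : 0 <= tail_bound r y t.
  apply: mulr_ge0 (expR_ge0 _); apply: mulr_ge0; apply: exprn_ge0; [exact: ler0n|exact: ltW].
have lam16 : lam <= expR (- (16%:R * t)) by apply: le_trans lamE (Emono 16%N 28 isT).
have sum_split c A : (n ^ (r - 2))%:R * c 2%N <= A ->
    (forall i, (3 <= i <= r)%N -> c i = clique_cost r p lam i) ->
    clique_sum n r c y <= e%:R * A + E 15.
  move=> cA cE.
  apply: le_trans (@clique_sum_split n r y c A (tail_bound r y t) r3 cA _ tail0) _.
    move=> i ir; rewrite cE //; apply: (later_clique_term (l := l)) => //; exact: ltW.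
  by rewrite mulrDr lerD // mulrA.
have first := @first_clique_term n r t l p lam kap r3 n_def l_def p_def.
have M1le : clique_sum n r (clique_cost r p lam) y / t <= expR (- M).
  rewrite ler_pdivrMr //.
  have := sum_split _ _ (lexx _) (fun _ _ => erefl); rewrite first => /le_trans; apply.
  have h : e%:R * (t / kap) * 2 = expR (- M) * t.
    by rewrite /kap expRN; field; rewrite !gt_eqF ?expR_gt0 //; clear -e1; lra.
  have : E 15 <= e%:R * (t / kap); last by clear -h; lra.
  apply: (@le_trans _ _ (t / kap)); last by rewrite ler_peMl // ltW.
  rewrite ler_pdivlMr // mulrC.
  apply: le_trans (poly_E kap 14 P2) _; apply: le_trans (E1 13%N) _; clear -t1; lra.
have M2le : clique_sum n r (clique_cost2 r p lam) y / eta <= expR (- M).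
  rewrite ler_pdivrMr //.
  have c2 : (n ^ (r - 2))%:R * clique_cost2 r p lam 2 <= t * E 32 * t.
    rewrite /clique_cost2 eqxx mulrCA first p_def.
    apply: ler_pM; [by rewrite mulr_ge0 ?expR_ge0 ?(ltW l0)|exact: ltW| |].
      by rewrite ler_wpM2r ?expR_ge0.
    by rewrite ler_pdivrMr // ler_peMr // ltW.
  apply: le_trans (sum_split _ _ c2 _) _.
    by move=> i /andP[i3 _]; rewrite /clique_cost2; case: eqP => // i2; rewrite i2 in i3.
  have h1 : e%:R * (t * E 32 * t) <= E 15.
    have e2 : e%:R * t ^+ 2 <= expR t.
      apply: le_trans P4; rewrite ler_wpM2r ?sqr_ge0 //; clear -e1; nra.
    rewrite [leLHS](_ : _ = e%:R * t ^+ 2 * E 32); last by ring.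
    by apply: le_trans (poly_E _ 31%N e2) (Emono _ _ _).
  have h2 : 2 * E 15 <= expR (- M) * eta.
    rewrite -(ler_pM2l (expR_gt0 M)) [leRHS]mulrA -expRD subrr expR0 mul1r.
    rewrite mulrCA mulrA.
    by apply: le_trans (poly_E _ 14%N P3) (Emono _ _ _).
  clear -h1 h2; lra.
have pow_le (x : R) : 0 <= x -> x <= expR (- M) -> x ^+ b <= expR (- (M * t)).
  move=> x0 xM; apply: (@le_trans _ _ (expR (- M) ^+ b)).
    by rewrite lerXn2r ?nnegrE ?expR_ge0.
  by rewrite -expRM_natr ler_expR mulNr lerN2 ler_wpM2l.
have cs0 c : (forall i, 0 <= c i) -> 0 <= clique_sum n r c y by apply: clique_sum_ge0.
have D2 : expR ((N ^ 2)%:R * (eta + lam)) <= 2.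
  have h : (N ^ 2)%:R * (eta + lam) <= 1 / 2.
    have hl : lam <= E 12 by apply: le_trans lamE (Emono 12%N 28 isT).
    have hN : (N ^ 2)%:R <= (2 * t * e%:R) ^+ 2.
      by rewrite natrX lerXn2r ?nnegrE // !mulr_ge0 // ltW.
    apply: (@le_trans _ _ ((2 * t * e%:R) ^+ 2 * (2 * E 12))).
      apply: ler_pM; rewrite ?ler0n ?addr_ge0 ?(ltW eta0) ?(ltW lam_gt0) //.
      rewrite /eta; clear -hl; lra.
    have := poly_E _ 11%N P4; have := E1 10%N.
    rewrite (_ : (2 * t * e%:R) ^+ 2 * (2 * E 12) = 16%:R * e%:R ^+ 2 * t ^+ 2 * E 12 / 2);
      last by field.
    clear; lra.
  have := expR_ge1Dx (- ((N ^ 2)%:R * (eta + lam))); rewrite expRN => h3.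
  have h4 : (1 / 2) <= (expR ((N ^ 2)%:R * (eta + lam)))^-1 by clear -h3 h; lra.
  rewrite -(ler_pM2l (expR_gt0 ((N ^ 2)%:R * (eta + lam)))) mulfV ?gt_eqF ?expR_gt0 // in h4.
  clear -h4; lra.
have small8 : expR (- (8%:R * t)) * 2 <= 1 / 4%:R.
  have := expR_ge1Dx (8%:R * t); rewrite expRN => h.
  rewrite mulrC ler_pdivrMr ?expR_gt0 //; clear -h t1; lra.
have finish m x : (m * (16 * (r + 1)) + 8 <= 64 * (r + 1) + 8)%N -> 0 <= x -> x <= expR (- M) ->
    (n ^ m)%:R * x ^+ b * expR ((N ^ 2)%:R * (eta + lam)) <= 1 / 4%:R.
  move=> mM x0 xM.
  apply: le_trans small8; apply: ler_pM; rewrite ?expR_ge0 ?mulr_ge0 ?exprn_ge0 ?ler0n //.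
  apply: (@le_trans _ _ ((n ^ m)%:R * expR (- (M * t)))).
    by rewrite ler_wpM2l ?ler0n // pow_le.
  rewrite natrX n_def -expRM_natl -expRD ler_expR mulrA -natrM.
  have : (m * (16 * (r + 1)) + 8)%:R <= M :> R by rewrite ler_nat.
  rewrite natrD => h; have := ler_wpM2r (ltW t0) h; clear; lra.
have H3 : 'C(n, k)%:R * expR (- (p * 'C(k, 2)%:R) +
     hit_rate t lam * ('C(k, 2)%:R * (t + lam) + ('C(k, 2) * k)%:R * (eta + lam))) <= 1 / 4%:R.
  have lamE12 : lam <= eta by apply: le_trans lamE (Emono 12%N 28 isT).
  have pk : p * k%:R <= 65%:R * a.
    have h := ler_wpM2l (ltW p0) k2.
    have h' : p * (64%:R * a / p + 1 + 1) = 64%:R * a + 2 * p.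
      by field; rewrite gt_eqF.
    rewrite h' in h; apply: le_trans h _.
    have h3 : 2 * p <= 1 by apply: le_trans plam2 _; clear -lam12; move: lam lam12 => x; lra.
    by clear -h3 a1; lra.
  have pk1 : 64%:R * a <= p * (k%:R - 1).
    have h := ler_wpM2l (ltW p0) k1.
    have h' : p * (64%:R * a / p + 1) = 64%:R * a + p by field; rewrite gt_eqF.
    by rewrite h' in h; clear -h; lra.
  have rate : hit_rate t lam = 2 * p ^+ 2 * expR (7%:R * t).
    have h7 : expR (7%:R * t) = expR (3%:R * t) ^+ 2 * expR t.
      by rewrite -expRM_natl -expRD; congr expR; ring.
    by rewrite /hit_rate /lam h7; ring.
  have r1 : hit_rate t lam * (t + lam) <= p / 8%:R.
    have h1 : 16%:R * t ^+ 2 * E 25 <= 1.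
      apply: le_trans (_ : E 24 <= 1); last by apply: le_trans (E1 23%N) _; clear; lra.
      apply: poly_E; apply: le_trans P4; rewrite ler_wpM2r ?sqr_ge0 //.
      by clear -e1; nra.
    have h7 : expR (7%:R * t) * E 32 = E 25.
      rewrite -(EE 7 25)%N mulrA (_ : expR (7%:R * t) * E 7 = 1) ?mul1r //.
      by rewrite -expRD subrr expR0.
    have h2 : t + lam <= 2 * t by clear -lam12 t1; move: lam lam12 => x; lra.
    rewrite rate.
    apply: (@le_trans _ _ (p * (l * (2 * t) * E 25))).
      rewrite [leRHS](_ : _ = 2 * p ^+ 2 * expR (7%:R * t) * (2 * t)).
        by rewrite ler_wpM2l // mulr_ge0 ?expR_ge0 // mulr_ge0 ?sqr_ge0.
      by rewrite -h7 /p; field.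
    rewrite ler_wpM2l ?(ltW p0) //.
    apply: (@le_trans _ _ (t * (2 * t) * E 25)).
      by rewrite !ler_wpM2r ?(ltW (E0 _)) // mulr_ge0 // ltW.
    rewrite expr2 in h1; clear -h1; move: (E 25) h1 => x; lra.
  (* The factor k coming from the shared larger end is harmless: p k is of order t, while e^(7 t)
     eta = e^(-5 t). *)
  have r2 : hit_rate t lam * k%:R * (eta + lam) <= p / 8%:R.
    have h7 : expR (7%:R * t) * E 12 = E 5.
      rewrite -(EE 7 5)%N mulrA (_ : expR (7%:R * t) * E 7 = 1) ?mul1r //.
      by rewrite -expRD subrr expR0.
    have h3 : 2080%:R * (r + 1)%:R * t * E 5 <= 1.
      apply: le_trans (poly_E _ 4%N P5) _; apply: le_trans (E1 3%N) _; clear; lra.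
    apply: (@le_trans _ _ (2 * p ^+ 2 * expR (7%:R * t) * k%:R * (2 * E 12))).
      rewrite rate; apply: ler_wpM2l.
        apply: mulr_ge0 (ler0n _ _); apply: mulr_ge0 (expR_ge0 _).
        by apply: mulr_ge0 (sqr_ge0 _).
      by rewrite /eta in lamE12 *; clear -lamE12; move: lam (E 12) lamE12 => x z; lra.
    rewrite [leLHS](_ : _ = p * ((p * k%:R) * (4%:R * E 5))); last first.
      by rewrite -h7; move: (E 12) (expR (7%:R * t)) (k%:R) => x z w; clear; move: p => q; ring.
    rewrite ler_wpM2l ?(ltW p0) //.
    have := ler_wpM2r (mulr_ge0 (ler0n R 4) (ltW (E0 5%N))) pk.
    rewrite /a; clear -h3; move: (E 5) h3 => x; lra.
  have C2 : 2 * 'C(k, 2)%:R = k%:R * (k%:R - 1) :> R.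
    rewrite -natrM doubled_bin2 natrM; case: (k) => [|m]; first by rewrite !mul0r.
    by rewrite /= -natr1 addrK.
  have kge : 1 <= k%:R :> R.
    apply: le_trans k1; rewrite lerDr divr_ge0 ?(ltW p0) // mulr_ge0 // (le_trans _ a1) //.
  have expo : - (p * 'C(k, 2)%:R) + hit_rate t lam * ('C(k, 2)%:R * (t + lam) +
       ('C(k, 2) * k)%:R * (eta + lam)) <= - (24%:R * a * k%:R).
    have C0 : 0 <= 'C(k, 2)%:R :> R by apply: ler0n.
    have hh1 := ler_wpM2l C0 r1; have hh2 := ler_wpM2l C0 r2.
    have hh3 := ler_wpM2r (ler0n R k) pk1.
    rewrite natrM.
    move: (hit_rate t lam) (t + lam) (eta + lam) ('C(k, 2)%:R) hh1 hh2 C2 => hr x1 x2 C hh1 hh2 C2.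
    have C2' : p * C = p * (k%:R - 1) * k%:R / 2.
      by rewrite (_ : C = k%:R * (k%:R - 1) / 2); [field|rewrite -C2; field].
    by clear -hh1 hh2 hh3 C2'; lra.
  apply: (@le_trans _ _ (expR (16%:R * a * k%:R) * expR (- (24%:R * a * k%:R)))).
    apply: ler_pM; rewrite ?ler0n ?expR_ge0 ?ler_expR //.
    apply: (@le_trans _ _ ((n ^ k)%:R)); first by rewrite ler_nat bin_le_exp.
    rewrite natrX n_def -expRM_natl ler_expR natrM /a; apply: eq_refl_le; ring.
  rewrite -expRD.
  have ak : 1 <= a * k%:R by rewrite -[leLHS]mulr1 ler_pM.
  have h : 9%:R <= expR (8%:R * (a * k%:R)) by apply: le_trans (expR_ge1Dx _); clear -ak; lra.
  rewrite (_ : _ + _ = - (8%:R * (a * k%:R))); last by ring.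
  rewrite expRN -div1r ler_pdivrMr ?expR_gt0 //; clear -h; lra.
have H1 := finish 2%N _ _ _ M1le.
have H2 := finish 4%N _ _ _ M2le.
have [|||||G [G1 G2 G3]] := @exists_clique_free_hitting_graph R n r p t eta lam r3 p0 t0 eta0 lam12 plam plam2 k b N y.
- exact: leqnn.
- exact: leqnn.
- apply: H1; first by clear; nia.
  apply: divr_ge0 (ltW t0); apply: cs0 => i; exact: clique_cost_ge0 p0 plam i.
- apply: H2; first by clear; nia.
  apply: divr_ge0 (ltW eta0); apply: cs0 => i; exact: clique_cost2_ge0 p0 plam i.
- exact: H3.
exists k, G; split=> //.
have kle : k%:R <= 65%:R * a / p.
  apply: le_trans k2 _; rewrite ler_pdivlMr // mulrDl mulrDl divfK ?gt_eqF // !mul1r.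
  have h3 : 2 * p <= 1 by apply: le_trans plam2 _; clear -lam12; move: lam lam12 => x; lra.
  by clear -h3 a1; lra.
apply: le_trans kle _; apply: eq_refl_le.
have e32 : E 32 = (expR (32%:R * t))^-1 by rewrite /E expRN.
have lE : l = (expR (ln kap / f) * expR (- (ln t / f)))^-1.
  rewrite -expRD -expRN /l ln_div ?posrE //; congr expR; field; by rewrite gt_eqF.
rewrite /p /a -/f e32 lE; field.
by rewrite !gt_eqF ?expR_gt0.
Qed.
End RamseyGraph.

(** * Conversion into powers of k and log k *)

Section Growth.
Variable R : realType.

Lemma eventually_le_ln (X : R) : exists k0 : nat, forall k : nat, (k0 <= k)%N ->
  [/\ 0 < k%:R :> R, X <= ln (k%:R : R) & k%:R = expR (ln k%:R) :> R].
Proof.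
have [k0 /andP[h _]] := nat_ceil (expR_ge0 X).
exists k0 => k kk.
have hk : expR X <= k%:R by apply: le_trans h _; rewrite ler_nat.
have k0' : 0 < k%:R :> R by apply: lt_le_trans hk; apply: expR_gt0.
split=> //; last by rewrite lnK // posrE.
by rewrite -[X]expRK ler_ln ?posrE ?expR_gt0.
Qed.

(** With t about (k/8)^(1/(r-2)) and j about k/2, the terms 4 t^(r-2) and j each take at most half
    of k. *)
Lemma lower_numbers r : (3 <= r)%N -> exists k0 : nat, forall k : nat, (k0 <= k)%N ->
  exists t j : nat, [/\ (0 < t)%N, (4 * t ^ (r - 2) + j <= k)%N &
    1 / 64%:R * expR ((r%:R - 1) / (r%:R - 2) * ln k%:R)
      * expR (- (1 / (r%:R - 2)) * ln (ln k%:R)) <= (t * j)%:R :> R].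
Proof.
move=> r3; pose d : R := (r - 2)%:R.
have d1 : 1 <= d by rewrite ler1n subn_gt0.
have d0 : 0 < d by apply: lt_le_trans d1.
have rd : r%:R - 2 = d by rewrite /d natrB // ltnW.
have rd1 : r%:R - 1 = d + 1 by rewrite -rd; ring.
have [k0 k0P] := eventually_le_ln (ln 8%:R + d * ln 2 + 1 + ln 4%:R).
exists k0 => k /k0P[kpos kln kE]; rewrite rd rd1.
have l2 : 0 <= ln (2:R) by apply: ln_ge0; rewrite ler1n.
have l4 : 0 <= ln (4:R) by apply: ln_ge0; rewrite ler1n.
have l8 : 0 <= ln (8:R) by apply: ln_ge0; rewrite ler1n.
pose x : R := ln k%:R.
have x1 : 1 <= x by have := mulr_ge0 (ltW d0) l2; rewrite /x; clear -kln l2 l4 l8; lra.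
have dl2 := mulr_ge0 (ltW d0) l2.
have k4 : 4%:R <= k%:R :> R.
  by rewrite kE -[leLHS]lnK ?posrE ?ltr0n // ler_expR; clear -kln l2 l4 l8 dl2; lra.
pose y := expR ((x - ln 8%:R) / d).
have yd : y ^+ (r - 2) = k%:R / 8%:R.
  by rewrite -expRM_natl -/d mulrC divfK ?gt_eqF // expRB -kE lnK // posrE ltr0n.
have y2 : 2 <= y.
  rewrite -[leLHS]lnK ?posrE ?ltr0n // ler_expR ler_pdivlMr // mulrC.
  rewrite /x; clear -kln l2 l4 l8 ; lra.
have [t /andP[t1 t2]] := @nat_ceil R (y - 1) ltac:(lra).
have [j /andP[j1 j2]] := @nat_ceil R (k%:R / 2 - 1) ltac:(lra).
exists t, j; split.
- rewrite -(ltr0n R); clear -y2 t1; lra.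
- rewrite -(ler_nat R) natrD natrM natrX.
  have : (t%:R : R) ^+ (r - 2) <= y ^+ (r - 2).
    rewrite lerXn2r ?nnegrE ?ler0n //; clear -y2 t2; lra.
  rewrite yd; clear -j2; lra.
(* The logarithmic factor is at most 1, since ln k >= 1. *)
have e1 : expR (- (1 / d) * ln x) <= 1.
  rewrite -[leRHS](@expR0 R) ler_expR mulNr oppr_le0 mulr_ge0 //.
    by rewrite divr_ge0 // ltW.
  by apply: ln_ge0.
have e2 : expR ((d + 1) / d * x) <= k%:R * (8%:R * y).
  rewrite kE -[X in _ * (X * _)](@lnK R) ?posrE ?ltr0n // -!expRD ler_expR -/x.
  have -> : (d + 1) / d * x = x + x / d by field; rewrite gt_eqF.
  rewrite lerD2l mulrBl; have : ln 8%:R / d <= ln (8%:R : R).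
    by rewrite ler_pdivrMr // ler_peMr.
  clear; lra.
apply: (@le_trans _ _ (1 / 64%:R * (k%:R * (8%:R * y)))).
  rewrite -[leRHS]mulr1; apply: ler_pM => //; rewrite ?expR_ge0 //.
    by rewrite mulr_ge0 ?expR_ge0 // divr_ge0.
  by rewrite ler_wpM2l // divr_ge0.
rewrite natrM.
have : (y / 2) * (k%:R / 4%:R) <= t%:R * j%:R.
  apply: ler_pM; clear -y2 k4 t1 j1; lra.
clear; lra.
Qed.

(* With gam = 1 - 1 / ('C(r, 2) - 1), the exponent of the logarithm is A * gam, and
   n = e^(16 (r + 1) t) turns n / k into n^(1/A) t^(- gam) up to a constant. *)
Theorem upper_graph r : (3 <= r)%N -> exists c2 : R, 0 < c2 /\
  exists k0 : nat, forall q : nat, (k0 <= q)%N ->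
  exists (n k : nat) (G : {set 'I_n * 'I_n}), [/\ G \subset prs setT,
    forall A : {set 'I_n}, #|A| = r -> ~~ (prs A \subset G),
    forall I : {set 'I_n}, #|I| = k -> ~~ [disjoint prs I & G],
    (q * k < n)%N &
    n%:R <= c2 * expR ((r%:R + 1) / (r%:R - 1) * ln q%:R) *
      expR (((r%:R + 1) / (r%:R - 1) - 2 / ((r%:R - 1) * (r%:R - 2))) * ln (ln q%:R))].
Proof.
move=> r3; have [T [c [T1 c0 TP]]] := exists_ramsey_graph R r3.
have r3R : 3%:R <= r%:R :> R by rewrite ler_nat.
pose f : R := ('C(r, 2) - 1)%:R.
have fE : 2 * f = (r%:R + 1) * (r%:R - 2).
  rewrite -[2]/(2%:R) /f -natrM -[X in (_ - X)%N]/('C(2, 2)) -clique_exponent2 //.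
  by rewrite natrM natrD natrB // ltnW.
pose A : R := (r%:R + 1) / (r%:R - 1).
pose gam : R := 1 - 1 / f.
have f0 : 2 <= f by clear -fE r3R; nra.
have f1 : 0 < f by clear -f0; lra.
(* A / f = 2 / ((r - 1) (r - 2)) is the correction in the exponent of the logarithm. *)
have betaE : A - 2 / ((r%:R - 1) * (r%:R - 2)) = A * gam.
  have -> : gam = 1 - 2 / ((r%:R + 1) * (r%:R - 2)).
    by rewrite /gam -fE; field; rewrite gt_eqF.
  have r1 : r%:R - 1 != 0 :> R by apply: lt0r_neq0; clear -r3R; lra.
  have r2 : r%:R - 2 != 0 :> R by apply: lt0r_neq0; clear -r3R; lra.
  have r3' : r%:R + 1 != 0 :> R by apply: lt0r_neq0; clear -r3R; lra.
  by rewrite /A; field; rewrite r1 r2 r3'.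
have A1 : 1 <= A by rewrite ler_pdivlMr; clear -r3R; lra.
have A2 : A <= 2 by rewrite ler_pdivrMr; clear -r3R; lra.
have gam0 : 0 <= gam.
  by rewrite /gam subr_ge0 ler_pdivrMr // mul1r; clear -f0; lra.
have gam1 : gam <= 1 by rewrite /gam gerBl divr_ge0 // ltW.
(* Strictly above ln c, whence the strict inequality q k < n. *)
pose w := ln (c + 1).
have w0 : 0 <= w by apply: ln_ge0; clear -c0; lra.
have cw : ln c < w by rewrite ltr_ln ?posrE //; clear -c0; lra.
pose c2 := 2 * expR (A * w).
pose s : R := (16 * (r + 1))%:R.
have sE : s = 16%:R * (r%:R + 1) by rewrite /s natrM natrD.
have s64 : 64%:R <= s by rewrite sE; clear -r3R; lra.
exists c2; split; first by rewrite mulr_gt0 ?expR_gt0.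
have [k0 k0P] := eventually_le_ln (1 + s * T + ln 2 + A * w).
exists k0 => q /k0P[qpos qln qE]; rewrite -/A betaE.
pose x : R := ln q%:R; rewrite -/x.
have l2 : 0 <= ln (2:R) by apply: ln_ge0; rewrite ler1n.
have sT : 0 <= s * T by clear -T1 s64; nra.
have Aw : 0 <= A * w by clear -A1 w0; nra.
have x1 : 1 <= x by rewrite /x; clear -qln l2 sT Aw; lra.
have lx0 : 0 <= ln x by apply: ln_ge0.
have lxx : ln x <= x.
  by rewrite -ler_expR lnK ?posrE; [have := expR_ge1Dx x; clear; lra|clear -x1; lra].
(* e^z = (e^w q (ln q)^gam)^A; the constant e^(A w) goes into [c2]. *)
pose z := A * (w + x + gam * ln x).
have [n /andP[n1 n2]] := nat_ceil (expR_ge0 z).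
have gl0 : 0 <= gam * ln x by rewrite mulr_ge0.
have z0 : 0 <= z by apply: mulr_ge0; clear -A1 x1 w0 gl0; lra.
have zE : c2 * expR (A * x) * expR (A * gam * ln x) = 2 * expR z.
  transitivity (2 * (expR (A * w) * expR (A * x) * expR (A * gam * ln x))).
    by rewrite /c2; ring.
  by rewrite -!expRD /z; congr (2 * expR _); ring.
have n_le : n%:R <= 2 * expR z by have := expR_ge1Dx z; clear -n2 z0; lra.
have npos : 0 < n%:R :> R by apply: lt_le_trans n1; apply: expR_gt0.
pose t := ln n%:R / s.
have tE : s * t = ln n%:R by rewrite mulrC divfK // gt_eqF //; clear -s64; lra.
have zn : z <= s * t.
  by rewrite tE -[z]expRK ler_ln ?posrE ?expR_gt0.
have nz : s * t <= ln 2 + z.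
  rewrite tE -[z]expRK -lnM ?posrE ?expR_gt0 // ler_ln ?posrE ?mulr_gt0 ?expR_gt0 //.
have gl1 : gam * ln x <= x by apply: le_trans lxx; rewrite ler_piMl.
have tT : T <= t.
  rewrite -(@ler_pM2l _ s); last by clear -s64; lra.
  apply: le_trans zn; rewrite /z.
  have : x <= A * (w + x + gam * ln x) by clear -A1 w0 x1 gl0; nra.
  rewrite /x; clear -qln l2 Aw; lra.
(* Lets ln (ln q) replace ln t at the end: n is at most a bounded multiple of q^4, while s >= 64. *)
have tx : t <= x.
  have h : z <= A * w + 4%:R * x by rewrite /z; clear -A2 A1 x1 gl0 gl1; nra.
  have t0 : 0 <= t by clear -tT T1; lra.
  have h1 : 64%:R * t <= s * t by rewrite ler_wpM2r.
  have h2 : A * w + ln 2 <= x by rewrite /x; clear -qln l2 sT; lra.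
  clear -h h1 h2 nz x1; lra.
have [|k [G [G1 G2 G3 Gk]]] := TP n t tT.
  by rewrite -/s tE lnK // posrE.
exists n, k, G; split=> //; last by rewrite zE.
have t0 : 0 < t by clear -tT T1; lra.
rewrite -(ltr_nat R) natrM; apply: le_lt_trans (ler_wpM2l (ltW qpos) Gk) _.
rewrite -/f qE -[X in _ * (X * _ * _ * _)](@lnK R) ?posrE // -[X in _ * (_ * X * _ * _)](@lnK R) ?posrE //.
rewrite -!expRD -[ltRHS](@lnK R) ?posrE // ltr_expR -tE -/x.
have ltx : gam * ln t <= gam * ln x by rewrite ler_wpM2l // ler_ln ?posrE //; clear -x1; lra.
have h1 : w + x + gam * ln x <= 16%:R * (r%:R - 1) * t.
  have := zn; rewrite /z => h; rewrite -(@ler_pM2l _ A); last by clear -A1; lra.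
  apply: le_trans h _; apply: eq_refl_le; rewrite sE /A; field; clear -r3R.
  rewrite gt_eqF //; lra.
have -> : ln t / f = ln t - gam * ln t by rewrite /gam; field; rewrite gt_eqF.
rewrite sE; clear -h1 ltx cw; lra.
Qed.
End Growth.

(** * Bounds on g(K_r, k) *)

Section Maximum.
Local Open Scope nat_scope.

(** Pigeonhole: with q colours on more than q k vertices, some colour class contains a k-set, which
    spans an edge. *)
Lemma hitting_graph_not_g_good (r n q k : nat) (G : {set 'I_n * 'I_n}) :
  G \subset prs setT ->
  (forall A : {set 'I_n}, #|A| = r -> ~~ (prs A \subset G)) ->
  (forall I : {set 'I_n}, #|I| = k -> ~~ [disjoint prs I & G]) ->
  q * k < n -> ~ g_good (@K r) q n.
Proof.
move=> /subsetP Gord Gfree Ghit qkn good.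
pose e : rel 'I_n := fun u v => ((u, v) \in G) || ((v, u) \in G).
have Glt u v : (u, v) \in G -> u < v by move/Gord; rewrite inE => /and3P[].
have [||c [cL ce]] := good n (leqnn n) e _ _ (fun _ => iota 0 q) (fun _ => conj (iota_uniq 0 q) (size_iota 0 q)).
- split=> [u|u v]; last by rewrite /e orbC.
  by apply/negP => /orP[] /Glt; rewrite ltnn.
- case=> f [f_inj fK]; have := Gfree (f @: setT).
  rewrite card_imset // cardsT card_ord => /(_ erefl)/negP; apply.
  apply/subsetP => -[u v]; rewrite inE /= => /and3P[/imsetP[i _ ->] /imsetP[j _ ->] fij].
  have /fK /orP[//|/Glt] : K i j by apply: contraTneq fij => ->; rewrite ltnn.
  by rewrite ltnNge ltnW.
have cq v : c v < q by have := cL v; rewrite mem_iota.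
have [a ka] : exists a : 'I_q, k <= #|[set v | c v == a]|.
  apply/existsP; rewrite -[X in is_true X]negbK negb_exists; apply/negP => /forallP small.
  move: qkn; apply/negP; rewrite -leqNgt -[leqLHS]card_ord -sum1_card.
  rewrite (partition_big (fun v => Ordinal (cq v)) xpredT) //=.
  apply: (@leq_trans (\sum_(a < q) k)); last by rewrite sum_nat_const card_ord.
  apply: leq_sum => a _; rewrite sum1_card.
  have := small a; rewrite -ltnNge => /ltnW; apply: leq_trans.
  by apply: subset_leq_card; apply/subsetP => v; rewrite !inE.
have [s [s_uniq ss sa]] := card_geqP ka.
have := Ghit [set v in s]; rewrite cardsE (card_uniqP s_uniq) => /(_ ss)/pred0Pn[[u v]].
rewrite /= !inE /= => /andP[/and3P[/sa + /sa + _] uvG].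
rewrite !inE => /eqP cu /eqP cv.
by have := ce u v; rewrite /e uvG cu cv eqxx => /(_ isT).
Qed.

Lemma g_good_le m (eH : rel 'I_m) q g g' : g <= g' -> g_good eH q g' -> g_good eH q g.
Proof. by move=> gg good n ng; apply: good; apply: leq_trans gg. Qed.

Lemma g_good0 m (eH : rel 'I_m) q : g_good eH q 0.
Proof. by move=> [|//] _ e _ _ L _; exists (fun _ => 0); split; case. Qed.

(** [epsilon] is meaningful only if a maximum exists. As [g_good] holds at 0 and fails at N,
    descending from N reaches the last good value. *)
Lemma g_fun_is_g m (eH : rel 'I_m) q N : ~ g_good eH q N -> is_g eH q (g_fun eH q).
Proof.
move=> bad; apply: ClassicalEpsilon.epsilon_spec.
elim: N bad => [/(_ (@g_good0 m eH q))//|N IH bad].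
have [good|/IH//] := Classical_Prop.classic (g_good eH q N).
exists N; split=> // g' good'; rewrite leqNgt; apply/negP => Ng.
exact/bad/(g_good_le Ng).
Qed.

Lemma g_fun_bounds m (eH : rel 'I_m) q N M : ~ g_good eH q N -> g_good eH q M ->
  M <= g_fun eH q <= N.
Proof.
move=> bad good; have [g1 g2] := g_fun_is_g bad; rewrite g2 //=.
by rewrite leqNgt; apply/negP => /ltnW Ng; apply/bad/(g_good_le Ng).
Qed.
End Maximum.

(** Powers are written as [expR (a * ln x)], the unfolding of [Rpower], so that the passage to the
    Stdlib reals is a mere rewriting. *)
Theorem g_fun_clique_bounds (R : realType) (r : nat) : (3 <= r)%N ->
  exists c1 c2 : R, [/\ 0 < c1, 0 < c2 & exists k0 : nat, forall k : nat, (k0 <= k)%N ->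
    c1 * expR ((r%:R - 1) / (r%:R - 2) * ln k%:R)
       * expR (- (1 / (r%:R - 2)) * ln (ln k%:R)) <= (g_fun (@K r) k)%:R /\
    (g_fun (@K r) k)%:R <= c2 * expR ((r%:R + 1) / (r%:R - 1) * ln k%:R) *
      expR (((r%:R + 1) / (r%:R - 1) - 2 / ((r%:R - 1) * (r%:R - 2))) * ln (ln k%:R))].
Proof.
move=> r3; have [k1 lower] := @lower_numbers R r r3.
have [c2 [c20 [k2 upper]]] := @upper_graph R r r3.
exists (1 / 64%:R), c2; split; [by rewrite divr_gt0 ?ltr0n|by []|].
exists (maxn k1 k2) => k.
rewrite geq_max => /andP[/lower low /upper upp].
have [t [j [t0 tj low_le]]] := low.
have [n [q [G [G1 G2 G3 kq upp_le]]]] := upp.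
have /andP[gl gu] : (t * j <= g_fun (@K r) k <= n)%N.
  apply: g_fun_bounds; first exact: hitting_graph_not_g_good G1 G2 G3 kq.
  move=> m mtj e simple free; exact: choosable_clique_free r3 t0 simple free mtj tj.
split; first by apply: le_trans low_le _; rewrite ler_nat.
by apply: le_trans upp_le; rewrite ler_nat.
Qed.

From Stdlib Require Import Reals.
Open Scope R_scope.

Theorem mainTheorem11 (r : nat) (hr : (3 <= r)%coq_nat) :
  exists c1 c2 : R, 0 < c1 /\ 0 < c2 /\
  exists k0 : nat, forall k : nat, (k0 <= k)%coq_nat ->
    c1 * Rpower (INR k) ((INR r - 1) / (INR r - 2))
       * Rpower (ln (INR k)) (- (1 / (INR r - 2)))
      <= INR (g_fun (@K r) k) /\
    INR (g_fun (@K r) k)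
      <= c2 * Rpower (INR k) ((INR r + 1) / (INR r - 1))
            * Rpower (ln (INR k))
                ((INR r + 1) / (INR r - 1)
                 - 2 / ((INR r - 1) * (INR r - 2))).
Proof.
have [c1 [c2 [c10 c20 [k0 bounds]]]] := @g_fun_clique_bounds R r (introT ssrnat.leP hr).
exists c1, c2; split; first exact/RltP.
split; first exact/RltP.
exists k0 => k /ssrnat.leP /bounds[lower upper].
have two : IZR 2 = INR 2 by rewrite IZRposE.
by rewrite /Rpower !RexpE !RlnE two !INRE; split; apply/RleP.
Qed.
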